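(* Let $A$ be a commutative Noetherian ring such that for every finite type $A$-algebra $S$ of dimension $\leq 2$, the free module $S^2$ is cancellative. Let $R$ be a ring of dimension $d\geq 2$ which is of finite type over $A$. Let $P$ be a projective $R$-module of rank $d$ with $\wedge^d(P)\simeq R$. Assume that there is an $R$-linear surjection $\alpha:P\twoheadrightarrow J$, where $J\subset R$ is an ideal of height $d$ which is generated by $d$ elements. Then $P\simeq Q\oplus R$ for some $R$-module $Q$.
   Context: All rings are commutative with $1$. The free module $S^2$ is cancellative if every $S$-module $M$ with $M\oplus S^m\simeq S^2\oplus S^m$ for some $m\ge 0$ is isomorphic to $S^2$. *)

(* Defs.v *)
From HB Require Import structures.
From mathcomp Require Import all_boot all_algebra.
From mathcomp Require Import boolp classical_sets.

Set Implicit Arguments.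
Unset Strict Implicit.
Unset Printing Implicit Defensive.

Import GRing.Theory.
Local Open Scope classical_set_scope.
Local Open Scope ring_scope.

Definition lmod_iso (R : pzRingType) (M N : lmodType R) : Prop :=
  exists f : {linear M -> N}, bijective f.

Definition generated_by (R : pzRingType) (M : lmodType R) (n : nat)
    (x : 'I_n -> M) (I : set M) : Prop :=
  I = range (fun a : 'I_n -> R => \sum_i a i *: x i).

Definition fg_module (R : pzRingType) (M : lmodType R) : Prop :=
  exists n (x : 'I_n -> M), generated_by x setT.

(* The unit ideal is allowed here, unlike in the library's [idealr_closed]. *)
Definition ideal (R : comPzRingType) (I : set R^o) : Prop :=
  submod_closed (mem I : {pred R^o}).

Definition noetherian (R : comPzRingType) : Prop :=
  forall I : set R^o, ideal I -> exists n (x : 'I_n -> R^o), generated_by x I.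

Definition finite_type (A : comPzRingType) (S : comAlgType A) : Prop :=
  exists n (x : 'I_n -> S), forall T : set S,
    subalg_closed (mem T : {pred S}) -> (forall i, T (x i)) -> T = setT.

Definition prime_ideal (R : comNzRingType) (p : set R) : Prop :=
  idealr_closed (mem p : {pred R}) /\ prime_idealr_closed (mem p : {pred R}).

(* c 0 < c 1 < ... < c n; the values of c beyond n are irrelevant. *)
Definition prime_chain (R : comNzRingType) (n : nat) (c : nat -> set R) : Prop :=
  (forall i, (i <= n)%N -> prime_ideal (c i)) /\
  (forall i, (i < n)%N -> c i `<` c i.+1).

Definition krull_dim_le (R : comNzRingType) (n : nat) : Prop :=
  forall m (c : nat -> set R), prime_chain m c -> (m <= n)%N.

Definition krull_dim (R : comNzRingType) (n : nat) : Prop :=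
  (exists c : nat -> set R, prime_chain n c) /\ krull_dim_le R n.

Definition prime_height (R : comNzRingType) (p : set R) (n : nat) : Prop :=
  (exists2 c : nat -> set R, prime_chain n c & c n = p) /\
  (forall m (c : nat -> set R), prime_chain m c -> c m = p -> (m <= n)%N).

(* The infimum of the heights of the primes containing I. A prime of infinite
   height has no [prime_height], so it imposes no condition in the second part;
   the unit ideal has no (finite) height. *)
Definition ideal_height (R : comNzRingType) (I : set R) (n : nat) : Prop :=
  (exists p : set R, [/\ prime_ideal p, I `<=` p & prime_height p n]) /\
  (forall (p : set R) m,
     prime_ideal p -> I `<=` p -> prime_height p m -> (n <= m)%N).

Definition projective (R : pzRingType) (P : lmodType R) : Prop :=
  forall (M N : lmodType R) (g : {linear M -> N}) (f : {linear P -> N}),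
    (forall y, exists x, g x = y) ->
    exists h : {linear P -> M}, forall x, g (h x) = f x.

(* [is_localization p loc]: loc exhibits Rp as the localization of R at p, i.e.
   elements outside p become units, every element of Rp is a fraction a / s
   with s outside p, and a / 1 = 0 only if s a = 0 for some s outside p. *)
Definition is_localization (R : comNzRingType) (p : set R)
    (Rp : comUnitRingType) (loc : {rmorphism R -> Rp}) : Prop :=
  [/\ forall s, ~ p s -> loc s \is a GRing.unit,
      forall z, exists a, exists2 s, ~ p s & z = loc a / loc s
    & forall a, loc a = 0 -> exists2 s, ~ p s & s * a = 0].

Definition is_localized_module (R : comNzRingType) (p : set R)
    (Rp : comUnitRingType) (loc : {rmorphism R -> Rp})
    (M : lmodType R) (Mp : lmodType Rp)
    (mloc : {linear M -> Mp | loc \; *:%R}) : Prop :=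
  (forall y, exists x, exists2 s, ~ p s & y = (loc s)^-1 *: mloc x) /\
  (forall x, mloc x = 0 -> exists2 s, ~ p s & s *: x = 0).

(* The localization of M at the prime p is free of rank n. *)
Definition rank_at (R : comNzRingType) (M : lmodType R) (p : set R) (n : nat)
    : Prop :=
  exists (Rp : comUnitRingType) (loc : {rmorphism R -> Rp}) (Mp : lmodType Rp)
    (mloc : {linear M -> Mp | loc \; *:%R}),
    [/\ is_localization p loc, is_localized_module p mloc
      & lmod_iso Mp 'rV[Rp]_n].

Definition projective_of_rank (R : comNzRingType) (P : lmodType R) (n : nat)
    : Prop :=
  [/\ fg_module P, projective P
    & forall p : set R, prime_ideal p -> rank_at P p n].

Definition alternating (R : pzRingType) (M N : lmodType R) (n : nat)
    (f : {ffun 'I_n -> M} -> N) : Prop :=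
  (forall (v : {ffun 'I_n -> M}) i a x y,
     f (finfun [eta v with i |-> a *: x + y]) =
     a *: f (finfun [eta v with i |-> x]) + f (finfun [eta v with i |-> y])) /\
  (forall (v : {ffun 'I_n -> M}) i j, i != j -> v i = v j -> f v = 0).

(* [is_exterior_power w]: E, with w v = v_0 /\ ... /\ v_(n-1), is the n-th
   exterior power of M, given by its universal property. *)
Definition is_exterior_power (R : comPzRingType) (M E : lmodType R) (n : nat)
    (w : {ffun 'I_n -> M} -> E) : Prop :=
  alternating w /\
  forall (N : lmodType R) (f : {ffun 'I_n -> M} -> N), alternating f ->
    exists2 g : {linear E -> N}, (forall v, g (w v) = f v)
      & forall h : {linear E -> N}, (forall v, h (w v) = f v) -> h =1 g.

Definition exterior_power_iso (R : comPzRingType) (M : lmodType R) (n : nat)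
    (L : lmodType R) : Prop :=
  exists (E : lmodType R) (w : {ffun 'I_n -> M} -> E),
    is_exterior_power w /\ lmod_iso E L.

Definition free_cancellative (S : pzRingType) (n : nat) : Prop :=
  forall (M : lmodType S) (m : nat),
    lmod_iso (M * 'rV[S]_m)%type ('rV[S]_n * 'rV[S]_m)%type ->
    lmod_iso M 'rV[S]_n.

(* Main.v *)
Require Import Defs.
From HB Require Import structures.
From mathcomp Require Import all_boot all_algebra.
From mathcomp Require Import boolp classical_sets ring.

(** Fix an isomorphism of the top exterior power of P with R, that is, an
    alternating form w on P^d of which all others are multiples ([volume_form]).
    A tuple p of vectors of P is a basis of P at the primes not containing w p.

    The criterion for splitting is the following. If the tuple X satisfies
    w X = 1 modulo the ideal I generated by alpha(X_1), .., alpha(X_{d-1}), then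
    the linear form
      phi = alpha + (1 - alpha(X_0)) w(-, X_1, .., X_{d-1})
    is surjective: it takes the values alpha(X_i) at X_i for i > 0, and the
    value 1 modulo I at X_0 ([unimodular_form]). The kernel of phi is then the
    required complement.

    To find X, lift generators of J to vectors p_i of P. Every prime containing
    J is maximal, because J has height d = dim R ([height_dim_maxprime]). Hence
    by prime avoidance the generators can be chosen so that R / (f_2, ..,
    f_{d-1}) has dimension at most 2, where f_i = alpha(p_i)
    ([general_generators]), and modifying the p_i by the kernel of alpha makes
    w p a unit modulo J ([lift_generators]).

    This unit c = w p is the obstruction. It is removed by the cancellation
    hypothesis for S = R / (f_2, .., f_{d-1}): the unimodular row (c, f_0, f_1)
    over S has a free kernel ([kernel_basis]), and the first coordinates of a
    suitable basis of the kernel are two new generators of J modulo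
    (f_2, .., f_{d-1}), related to f_0, f_1 by a matrix of determinant inverse
    to c modulo J. With the corresponding new p_0, p_1 one has w p = 1
    modulo J ([reorient]).

    After one more step of general position ([cut_dimension]) R / I has
    dimension at most 1. There p_0 vanishes nowhere, since w p = 1 where f_0
    vanishes and alpha(p_0) = f_0 elsewhere. The other p_i may be changed by the
    elements f_0 y - alpha(y) p_0 of the kernel of alpha. In dimension one these
    are enough to make all but the last of them, together with p_0, independent
    at every prime over I ([extend_frame], [frames]), and the last one can then
    be adjusted to give w p = 1 modulo I ([unimodular_tuple]).

    All the avoidance arguments are instances of [general_position]. The
    finiteness of the sets of primes involved comes from Hilbert's basis theorem
    ([finite_type_noetherian]), and the rank of P enters only through Cramer's
    rule at each prime ([volume_local]). *)

Set Implicit Arguments.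
Unset Strict Implicit.
Unset Printing Implicit Defensive.

Import GRing.Theory.
Local Open Scope classical_set_scope.
Local Open Scope ring_scope.

(** * Submodules, ideals and primes *)

Definition submodule (R : pzRingType) (V : lmodType R) (Y : set V) : Prop :=
  submod_closed (mem Y : {pred V}).

Section Submodules.
Variables (R : pzRingType) (V : lmodType R).
Implicit Types (Y G : set V) (x y : V).

Lemma submoduleP Y :
  submodule Y <-> Y 0 /\ forall a x y, Y x -> Y y -> Y (a *: x + y).
Proof.
split=> [[/asboolP Y0 YP]|[Y0 YP]]; split => //; try exact/asboolP.
  by move=> a x y /asboolP Yx /asboolP Yy; apply/asboolP/YP.
by move=> a x y /asboolP Yx /asboolP Yy; apply/asboolP/YP.
Qed.

Lemma submod0 Y : submodule Y -> Y 0.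
Proof. by case/submoduleP. Qed.

Lemma submodZ Y a x : submodule Y -> Y x -> Y (a *: x).
Proof. by case/submoduleP => Y0 YP Yx; rewrite -[_ *: _]addr0; apply: YP. Qed.

Lemma submodD Y x y : submodule Y -> Y x -> Y y -> Y (x + y).
Proof. by case/submoduleP => _ YP Yx Yy; rewrite -[x]scale1r; apply: YP. Qed.

Lemma submod_sum Y (I : Type) (r : seq I) (Q : pred I) (F : I -> V) :
  submodule Y -> (forall i, Q i -> Y (F i)) -> Y (\sum_(i <- r | Q i) F i).
Proof.
move=> sY YF; apply: (big_ind Y) => //; first exact: submod0.
by move=> x y; apply: submodD.
Qed.

(** The submodule generated by G, in the form that makes every proof about its
    elements an application of minimality. *)
Definition span G : set V :=
  [set x | forall Y, submodule Y -> G `<=` Y -> Y x].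

Lemma span_submodule G : submodule (span G).
Proof.
apply/submoduleP; split; first by move=> Y sY _; apply: submod0.
move=> a x y Gx Gy Y sY GY.
by apply: submodD => //; [apply: submodZ => //; apply: Gx | apply: Gy].
Qed.

Lemma sub_span G : G `<=` span G.
Proof. by move=> x Gx Y _; apply. Qed.

Lemma span_min G Y : submodule Y -> G `<=` Y -> span G `<=` Y.
Proof. by move=> sY GY x; apply. Qed.

End Submodules.

Lemma span_add1 (R : pzRingType) (V : lmodType R) (Y : set V) (g : V) (x : V) :
  submodule Y -> span (Y `|` [set g]) x ->
  exists2 y, Y y & exists a, x = y + a *: g.
Proof.
move=> sY; apply: (@span_min _ _ _
  [set x | exists2 y, Y y & exists a, x = y + a *: g]).
  apply/submoduleP; split.
    by exists 0; [exact: submod0 | exists 0; rewrite scale0r addr0].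
  move=> a _ _ [y1 Y1 [a1 ->]] [y2 Y2 [a2 ->]].
  exists (a *: y1 + y2); first by apply: submodD => //; apply: submodZ.
  by exists (a * a1 + a2); rewrite scalerDr scalerDl scalerA addrACA.
move=> y [Yy|->]; first by exists y => //; exists 0; rewrite scale0r addr0.
by exists 0; [exact: submod0 | exists 1; rewrite scale1r add0r].
Qed.

Lemma preim_submodule (R : pzRingType) (V W : lmodType R)
    (f : {linear V -> W}) (Y : set W) : submodule Y -> submodule (f @^-1` Y).
Proof.
move=> sY; apply/submoduleP; split; rewrite /preimage/=.
  by rewrite linear0; apply: submod0.
by move=> a x y Yx Yy; rewrite linearP; apply: submodD => //; apply: submodZ.
Qed.

Section Ideals.
Variable R : comNzRingType.
Implicit Types (I p q : set R) (a b c x y : R).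

Lemma idealP I :
  ideal I <-> [/\ I 0, forall x y, I x -> I y -> I (x + y)
                & forall a x, I x -> I (a * x)].
Proof.
split=> [hI|[I0 ID IM]].
  split; [exact: (submod0 hI)| |].
  - by move=> x y; apply: (submodD hI).
  - by move=> a x; apply: (@submodZ _ R^o _ _ _ hI).
by apply/submoduleP; split => // a x y Ix Iy; apply: ID => //; apply: IM.
Qed.

Lemma ideal0 I : ideal I -> I 0. Proof. by case/idealP. Qed.
Lemma idealD I x y : ideal I -> I x -> I y -> I (x + y).
Proof. by case/idealP => _ + _; apply. Qed.
Lemma idealMl I a x : ideal I -> I x -> I (a * x).
Proof. by case/idealP => _ _; apply. Qed.
Lemma idealMr I a x : ideal I -> I x -> I (x * a).
Proof. by move=> hI Ix; rewrite mulrC; apply: idealMl. Qed.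
Lemma idealN I x : ideal I -> I x -> I (- x).
Proof. by move=> hI Ix; rewrite -mulN1r; apply: idealMl. Qed.
Lemma idealB I x y : ideal I -> I x -> I y -> I (x - y).
Proof. by move=> hI Ix Iy; apply: idealD => //; apply: idealN. Qed.
Lemma ideal_sum I (T : Type) (r : seq T) (Q : pred T) (F : T -> R) :
  ideal I -> (forall i, Q i -> I (F i)) -> I (\sum_(i <- r | Q i) F i).
Proof. exact: (@submod_sum _ R^o). Qed.
Lemma idealDr I x y : ideal I -> I x -> I (x + y) -> I y.
Proof. by move=> hI Ix Ixy; rewrite -(addKr x y) addrC; apply: idealB. Qed.

Lemma prime_idealP p :
  prime_ideal p <-> [/\ ideal p, ~ p 1 & forall x y, p (x * y) -> p x \/ p y].
Proof.
split=> [[[/asboolP p0 p1 pl] pp]|[/submoduleP[p0 pl] p1 pp]].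
  split; last by move=> x y /asboolP/pp/orP[]/asboolP; [left|right].
    apply/submoduleP; split=> // a x y /asboolP px /asboolP py.
    exact/asboolP/pl.
  by move/asboolP; apply/negP.
split; [split|]; [exact/asboolP|by apply/negP => /asboolP| |].
  by move=> a x y /asboolP px /asboolP py; apply/asboolP/pl.
by move=> x y /asboolP/pp[pz|pz]; apply/orP; [left|right]; apply/asboolP.
Qed.

Lemma prime_is_ideal p : prime_ideal p -> ideal p.
Proof. by case/prime_idealP. Qed.
Lemma prime1 p : prime_ideal p -> ~ p 1.
Proof. by case/prime_idealP. Qed.
Lemma primeM p x y : prime_ideal p -> p (x * y) -> p x \/ p y.
Proof. by case/prime_idealP => _ _; apply. Qed.
Lemma primeMN p x y : prime_ideal p -> ~ p x -> ~ p y -> ~ p (x * y).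
Proof. by move=> hp px py /(primeM hp)[]. Qed.
Definition gen (G : set R) : set R := @span R R^o G.

Lemma gen_ideal G : ideal (gen G).
Proof. exact: (@span_submodule R R^o G). Qed.
Lemma sub_gen G : G `<=` gen G.
Proof. exact: (@sub_span R R^o G). Qed.
Lemma gen_min G I : ideal I -> G `<=` I -> gen G `<=` I.
Proof. exact: (@span_min R R^o G). Qed.
Lemma gen_add1 I g x : ideal I -> gen (I `|` [set g]) x ->
  exists2 y, I y & exists a, x = y + a * g.
Proof. exact: (@span_add1 R R^o). Qed.

End Ideals.

(** * Primes over an ideal of a Noetherian ring *)

Section Noetherian.
Variable R : comNzRingType.
Hypothesis noeR : noetherian R.
Implicit Types (I p q : set R).

(** Ascending chains of ideals stabilize, since finitely many generators of the
    union already occur at a finite stage; hence an ideal with a property [bad]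
    that fails at all strictly larger ideals exists as soon as [bad] holds
    somewhere. *)
Lemma noetherian_max (bad : set R -> Prop) I0 :
  ideal I0 -> bad I0 ->
  exists I, [/\ ideal I, bad I, I0 `<=` I
    & forall I', ideal I' -> I `<=` I' -> bad I' -> I' `<=` I].
Proof.
move=> idI0 badI0; apply: contrapT => noMax.
pose T := {I : set R | [/\ ideal I, bad I & I0 `<=` I]}.
have next (I : T) : {I' : T | sval I `<=` sval I' /\ ~ sval I' `<=` sval I}.
  apply: cid; case: I => I [idI badI I0I] /=.
  apply: contrapT => noI'; apply: noMax; exists I; split => // I' idI' II' badI'.
  apply: contrapT => I'I; apply: noI'.
  have hI' : [/\ ideal I', bad I' & I0 `<=` I'] by split=> //; apply: subset_trans II'.
  by exists (exist _ I' hI').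
pose C : nat -> T := fun n => iter n (fun I : T => sval (next I) : T)
  (exist _ I0 (And3 idI0 badI0 (@subset_refl _ I0)) : T).
have CS n : sval (C n) `<=` sval (C n.+1) /\
    ~ sval (C n.+1) `<=` sval (C n) by exact: (svalP (next (C n))).
have Cmono m n : (m <= n)%N -> sval (C m) `<=` sval (C n).
  elim: n => [|n IH]; first by rewrite leqn0 => /eqP ->.
  rewrite leq_eqVlt => /orP[/eqP-> //|]; rewrite ltnS => /IH Hn.
  by apply: subset_trans Hn _; case: (CS n).
have idC n : ideal (sval (C n)) by case: (svalP (C n)).
pose U : set R := [set x | exists n, sval (C n) x].
have idU : ideal U.
  apply/idealP; split; first by exists 0%N; apply: ideal0.
  - move=> x y [m mx] [n ny]; exists (maxn m n); apply: idealD => //.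
      exact: (Cmono _ _ (leq_maxl _ _)) mx.
    exact: Cmono (leq_maxr _ _) _ ny.
  - by move=> a x [n nx]; exists n; apply: idealMl.
have [n [g gU]] := noeR idU.
have Ug i : U (g i).
  rewrite gU; exists (fun j => (j == i)%:R) => //.
  rewrite (bigD1 i) //= eqxx scale1r big1 ?addr0 // => j /negbTE ->.
  by rewrite scale0r.
have [N Ng] : exists N, forall i, sval (C N) (g i).
  exists (\max_i sval (cid (Ug i))) => i.
  by apply: Cmono (svalP (cid (Ug i))); apply: leq_bigmax.
case: (CS N) => _; apply => x Cx.
have : U x by exists N.+1.
rewrite gU => -[a _ <-]; apply: ideal_sum => // i _; exact: idealMl.
Qed.

(** Noetherian induction: at a largest ideal violating the claim there are x, y
    outside I with x y in I, and the primes over I are those over I + (x) or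
    over I + (y). *)
Lemma primes_over I : ideal I ->
  exists L : seq (set R), (forall p, p \in L -> prime_ideal p /\ I `<=` p) /\
    forall q, prime_ideal q -> I `<=` q -> exists2 p, p \in L & p `<=` q.
Proof.
move=> idI.
pose good I := exists L : seq (set R),
  (forall p, p \in L -> prime_ideal p /\ I `<=` p) /\
    forall q, prime_ideal q -> I `<=` q -> exists2 p, p \in L & p `<=` q.
apply: contrapT => badI.
have [M [idM badM _ maxM]] := noetherian_max (bad := fun I => ~ good I) idI badI.
have goodM x : ~ M x -> good (gen (M `|` [set x])).
  move=> Mx; apply: contrapT => badx; apply: Mx.
  suff sub : gen (M `|` [set x]) `<=` M.
    by apply: sub; apply: sub_gen; right.
  apply: maxM => //; first exact: gen_ideal.
  by move=> y' My; apply: sub_gen; left.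
case: (pselect (M 1)) => [M1|M1].
  apply: badM; exists [::]; split => // q hq Mq.
  by case: (prime1 hq); apply: Mq.
case: (pselect (forall x y, M (x * y) -> M x \/ M y)) => [pM|].
  apply: badM; exists [:: M]; split => [p|q _ Mq]; last by exists M; rewrite ?inE.
  by rewrite inE => /eqP ->; split => //; apply/prime_idealP.
move/existsNP => [x /existsNP[y /not_implyP[Mxy /not_orP[Mx My]]]].
have [Lx [Lx1 Lx2]] := goodM x Mx.
have [Ly [Ly1 Ly2]] := goodM y My.
apply: badM; exists (Lx ++ Ly); split.
  move=> p; rewrite mem_cat => /orP[/Lx1|/Ly1] [hp Mp]; split => // z Mz.
    by apply: Mp; apply: sub_gen; left.
  by apply: Mp; apply: sub_gen; left.
move=> q hq Mq; case: (primeM hq (Mq _ Mxy)) => [qx|qy].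
  have [|p pL pq] := Lx2 q hq; last by exists p; rewrite // mem_cat pL.
  by apply: gen_min => [|z [/Mq //|->//]]; apply: prime_is_ideal.
have [|p pL pq] := Ly2 q hq; last by exists p; rewrite // mem_cat pL orbT.
by apply: gen_min => [|z [/Mq //|->//]]; apply: prime_is_ideal.
Qed.

(** A largest proper ideal is prime. *)
Lemma ideal_no_prime I : ideal I -> (forall p, prime_ideal p -> ~ I `<=` p) -> I 1.
Proof.
move=> idI noP; apply: contrapT => I1.
have [M [idM M1 IM maxM]] := noetherian_max (bad := fun I => ~ I 1) idI I1.
apply: (noP M) IM; apply/prime_idealP; split => // x y Mxy.
have hx z : ~ M z -> exists2 m, M m & exists a, 1 = m + a * z.
  move=> Mz; apply: gen_add1 => //; apply: contrapT => bad; apply: Mz.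
  suff sub : gen (M `|` [set z]) `<=` M.
    by apply: sub; apply: sub_gen; right.
  apply: maxM => //; first exact: gen_ideal.
  by move=> y' My; apply: sub_gen; left.
apply: contrapT => /not_orP[/hx[m Mm [a E1]] /hx[n Mn [b E2]]]; apply: M1.
rewrite -[1]mulr1 {1}E1 E2 mulrDl; apply: idealD => //; first exact: idealMr.
rewrite mulrDr; apply: idealD => //; first exact: idealMl.
by rewrite mulrACA; apply: idealMl.
Qed.

End Noetherian.

(** * General position with respect to finitely many primes *)

Section GeneralPosition.
Variable R : comNzRingType.
Implicit Types (I p q u : set R) (L T U : seq (set R)).

(** The product of elements chosen in each t outside u. *)
Lemma inter_notin T u : prime_ideal u ->
  (forall t, t \in T -> ideal t /\ ~ t `<=` u) ->
  exists2 c, ~ u c & forall t, t \in T -> t c.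
Proof.
move=> hu; elim: T => [|t T IH] hT.
  by exists 1 => //; apply: prime1.
have [|c uc Tc] := IH; first by move=> s sT; apply: hT; rewrite inE sT orbT.
have [idt /existsNP[b /not_implyP[tb ub]]] := hT t (mem_head _ _).
exists (b * c); first exact: primeMN.
move=> s; rewrite inE => /orP[/eqP ->|sT]; first exact: idealMr.
apply: idealMl; last exact: Tc.
by have [] := hT s; rewrite ?inE ?sT ?orbT.
Qed.

Lemma minimal_in U : U != [::] ->
  exists2 u, u \in U & forall v, v \in U -> v `<=` u -> v = u.
Proof.
elim: U => // u U IH _; have [->|/IH[m mU minm]] := eqVneq U [::].
  by exists u; rewrite ?inE // => v; rewrite inE => /eqP.
have [um|um] := pselect (u `<=` m).
  exists u; first exact: mem_head.
  move=> v; rewrite inE => /orP[/eqP //|vU] vu.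
  have vm : v = m by apply: minm => //; apply: subset_trans um.
  by apply/seteqP; split => //; rewrite vm.
exists m; first by rewrite inE mU orbT.
by move=> v; rewrite inE => /orP[/eqP -> //|vU]; apply: minm.
Qed.

(** The common mechanism of all avoidance arguments: a point x of a module can
    be moved inside x + Y so as to be good at finitely many primes at once, when
    it can be moved at each of them and a multiple c y with c in u does not
    matter at u. The primes are treated in an order in which no prime contains a
    later one, so that c can be taken in all earlier ones. *)
Lemma general_position (V : lmodType R) (Y : set V) (U : seq (set R))
    (good : set R -> V -> Prop) (x : V) :
  submodule Y -> (forall u, u \in U -> prime_ideal u) ->
  (forall u z c y, u \in U -> u c -> Y y -> good u z -> good u (z + c *: y)) ->
  (forall u z c, u \in U -> Y (z - x) -> ~ u c ->
     exists2 y, Y y & good u (z + c *: y)) ->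
  exists2 y, Y y & forall u, u \in U -> good u (x + y).
Proof.
move=> sY; move: {2}(size U) (leqnn (size U)) => n.
elim: n U => [|n IH] U szU pU stab move_.
  exists 0; first exact: submod0.
  by move=> u uU; move: szU uU; rewrite leqn0 size_eq0 => /eqP ->.
have [U0|/minimal_in[u uU minu]] := eqVneq U [::].
  by exists 0; [exact: submod0 | rewrite U0].
pose U' := [seq v <- U | v != u].
have UU' v : v \in U' -> v \in U by rewrite mem_filter => /andP[].
have [||||y Yy goody] := IH U'.
- rewrite -ltnS; apply: leq_trans szU; rewrite size_filter -(count_predC (pred1 u)).
  by rewrite -[X in (X < _)%N]add0n ltn_add2r -has_count has_pred1.
- by move=> v /UU'/pU.
- by move=> v z c y /UU'; apply: stab.
- by move=> v z c /UU'; apply: move_.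
have [t|c uc U'c] := @inter_notin U' u (pU _ uU).
  rewrite mem_filter => /andP[tu tU]; split; first exact/prime_is_ideal/pU.
  by move/(minu _ tU)/eqP; apply/negP.
have [|y' Yy' goody'] := move_ u (x + y) c uU _ uc; first by rewrite addrC addKr.
exists (y + c *: y'); first by apply: submodD => //; apply: submodZ.
move=> v vU; rewrite addrA; have [-> //|vu] := eqVneq v u.
have vU' : v \in U' by rewrite mem_filter vu.
by apply: stab => //; [apply: U'c | apply: goody].
Qed.

(** Prime avoidance for the intersection of T. *)
Lemma avoid_primes T U :
  (forall t, t \in T -> ideal t) -> (forall u, u \in U -> prime_ideal u) ->
  (forall t u, t \in T -> u \in U -> ~ t `<=` u) ->
  exists c, (forall t, t \in T -> t c) /\ (forall u, u \in U -> ~ u c).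
Proof.
move=> idT pU TU.
pose Y : set R^o := [set y | forall t, t \in T -> t y].
have sY : submodule Y.
  apply/idealP; split => [t /idT/ideal0 //|y z Yy Yz t tT|a y Yy t tT].
    by apply: idealD; [exact: idT|exact: Yy|exact: Yz].
  by apply: idealMl; [exact: idT|exact: Yy].
have [||||c Yc Uc] := @general_position R^o Y U (fun u z => ~ u z) 0.
- exact: sY.
- exact: pU.
- move=> u z c y uU uc Yy uz; rewrite addrC => h; apply: uz.
  have idu := prime_is_ideal (pU _ uU).
  exact: (idealDr idu (idealMr y idu uc) h).
- move=> u z c uU _ uc; have [uz|uz] := pselect (u z); last first.
    by exists 0; [exact: (submod0 sY)|rewrite scaler0 addr0].
  have [t tT|y uy Ty] := @inter_notin T u (pU _ uU).
    by split; [exact: idT|exact: TU].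
  exists y => //= uzy; have : u (c * y).
    exact: (idealDr (prime_is_ideal (pU _ uU)) uz uzy).
  exact: (primeMN (pU _ uU)).
by exists c; split=> // u /Uc; rewrite add0r.
Qed.

End GeneralPosition.

(** * Dimension *)

Section Dimension.
Variable R : comNzRingType.
Hypothesis noeR : noetherian R.
Implicit Types (I J p q : set R).

Definition maxprime p : Prop := forall q, prime_ideal q -> p `<=` q -> q `<=` p.

(** The quotient by I has Krull dimension at most n. *)
Definition dim_over I (n : nat) : Prop :=
  forall m (c : nat -> set R), prime_chain m c -> I `<=` c 0%N -> (m <= n)%N.

Lemma maxprime_inv p x : prime_ideal p -> maxprime p -> ~ p x ->
  exists y, p (1 - y * x).
Proof.
move=> hp maxp px; pose K := gen (p `|` [set x]).
have : K 1.
  apply: ideal_no_prime => //; first exact: gen_ideal.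
  move=> q hq Kq; apply: px; have qp : q `<=` p; last first.
    by apply: qp; apply: Kq; apply: sub_gen; right.
  by have /(maxp q hq) : p `<=` q by move=> z pz; apply: Kq; apply: sub_gen; left.
move/gen_add1 => []; first exact: prime_is_ideal.
by move=> y py [a E]; exists a; rewrite E addrK.
Qed.

Lemma prime_chain_cons n c p : prime_ideal p -> p `<` c 0%N ->
  prime_chain n c -> prime_chain n.+1 (fun i => if i is j.+1 then c j else p).
Proof. by move=> hp pc [hc ltc]; split=> -[|i] //=; [apply: hc|apply: ltc]. Qed.

Lemma prime_chain_rcons n c p : prime_ideal p -> c n `<` p ->
  prime_chain n c -> prime_chain n.+1 (fun i => if (i <= n)%N then c i else p).
Proof.
move=> hp cp [hc ltc]; split=> i /=; first by case: ifP => // + _; apply: hc.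
rewrite ltnS => lein; rewrite lein; have [ltin|] := ltnP i n; first exact: ltc.
by move=> leni; rewrite (_ : i = n) //; apply/eqP; rewrite eqn_leq lein.
Qed.

(** The list L contains the minimal primes over I, and J lies in none of them
    that is not maximal. So the bottom of a nontrivial chain of primes over J is
    not minimal over I, and the chain can be prolonged downwards over I. *)
Lemma dim_over_cut I J n (L : seq (set R)) :
  (forall p, p \in L -> prime_ideal p) ->
  (forall q, prime_ideal q -> I `<=` q -> exists2 p, p \in L & p `<=` q) ->
  (forall p, p \in L -> I `<=` p) ->
  I `<=` J -> (forall p, p \in L -> J `<=` p -> maxprime p) ->
  dim_over I n.+1 -> dim_over J n.
Proof.
move=> hL coverL IL IJ JL dimI [//|m] c chc Jc.
have hc0 : prime_ideal (c 0%N) by apply: (proj1 chc).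
have [p pL pc] := coverL _ hc0 (subset_trans IJ Jc).
have [cp|ncp] := pselect (c 0%N `<=` p).
  have := JL p pL (subset_trans Jc cp) (c 1%N) (proj1 chc 1%N isT).
  have [lt01 nlt01] := (proj2 chc 0%N isT).
  move=> /(_ (subset_trans pc lt01)) c1p.
  by case: nlt01; apply: subset_trans c1p pc.
have := dimI _ _ (@prime_chain_cons _ c p (hL p pL) (conj pc ncp) chc).
by rewrite ltnS; apply; exact: IL.
Qed.

Lemma dim_over1_max I p q : dim_over I 1 -> prime_ideal p -> prime_ideal q ->
  I `<=` p -> p `<=` q -> ~ q `<=` p -> maxprime q.
Proof.
move=> dimI hp hq Ip pq nqp r hr qr; apply: contrapT => nrq.
pose c i := if i is 0 then p else if i is 1 then q else r.
have chc : prime_chain 2 c.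
  by split; [move=> [|[|]]|move=> [|[|]]].
by have := dimI _ _ chc Ip.
Qed.

(** Some chain of length at least d ends at q; a prime strictly above q would
    prolong it beyond the dimension. *)
Lemma height_dim_maxprime J d : krull_dim R d -> ideal_height J d ->
  forall q, prime_ideal q -> J `<=` q -> maxprime q.
Proof.
move=> [_ dimR] [_ htJ] q hq Jq r hr qr; apply: contrapT => nrq.
pose P m := `[<exists2 c, prime_chain m c & c m = q>].
have P0 : exists m, P m.
  by exists 0%N; apply/asboolP; exists (fun=> q).
have Pd m : P m -> (m <= d)%N by move/asboolP => [c /dimR].
have : prime_height q (ex_maxn P0 Pd).
  case: ex_maxnP => m /asboolP Pm maxm; split => // k c ck cq.
  by apply: maxm; apply/asboolP; exists c.
move/(htJ _ _ hq Jq); case: ex_maxnP => m /asboolP[c chc cm] _ dm.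
have := dimR _ _ (@prime_chain_rcons m c r hr _ chc).
rewrite cm => /(_ (conj qr nrq)) md; have := leq_trans md dm.
by rewrite ltnn.
Qed.

End Dimension.

(** * Algebras of finite type over a Noetherian ring *)

Section HilbertBasis.
Variables (A : comPzRingType) (R : comAlgType A).
Implicit Types (B I K : set R) (s : seq R).

Definition submod_over B K : Prop :=
  [/\ K 0, forall x y, K x -> K y -> K (x + y)
    & forall b x, B b -> K x -> K (b * x)].

(** That [s] generates I over B is expressed by minimality: I lies in every
    B-submodule containing [s]. *)
Definition noetherian_subring B : Prop :=
  forall I, I `<=` B -> submod_over B I ->
    exists2 s : seq R, (forall y, y \in s -> I y)
      & forall K, submod_over B K -> (forall y, y \in s -> K y) -> I `<=` K.

Definition subalgebra B : Prop :=
  [/\ forall a : A, B a%:A, forall x y, B x -> B y -> B (x + y)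
    & forall x y, B x -> B y -> B (x * y)].

Definition poly_over B (p : {poly R}) : Prop := forall i, B p`_i.

Definition adjoin B (x : R) : set R :=
  [set y | exists2 p, poly_over B p & y = p.[x]].

Section Adjoin.
Variables (B : set R) (x : R).
Hypotheses (algB : subalgebra B) (noeB : noetherian_subring B).

Let B0 : B 0. Proof. by case: algB => + _ _ => /(_ 0); rewrite scale0r. Qed.
Let B1 : B 1. Proof. by case: algB => + _ _ => /(_ 1); rewrite scale1r. Qed.
Let BD y z : B y -> B z -> B (y + z). Proof. by case: algB => _ + _; apply. Qed.
Let BM y z : B y -> B z -> B (y * z). Proof. by case: algB => _ _; apply. Qed.
Let BN y : B y -> B (- y).
Proof.
move=> By; rewrite -mulN1r; apply: BM => //.
by case: algB => + _ _ => /(_ (-1)); rewrite scaleN1r.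
Qed.

Let poC c : B c -> poly_over B c%:P.
Proof. by move=> Bc i; rewrite coefC; case: ifP. Qed.
Let poX : poly_over B 'X.
Proof. by move=> i; rewrite coefX; case: eqP. Qed.
Let poD p q : poly_over B p -> poly_over B q -> poly_over B (p + q).
Proof. by move=> Bp Bq i; rewrite coefD; apply: BD. Qed.
Let poM p q : poly_over B p -> poly_over B q -> poly_over B (p * q).
Proof.
move=> Bp Bq i; rewrite coefM; apply: (big_ind B) => // j _; exact: BM.
Qed.
Let poN p : poly_over B p -> poly_over B (- p).
Proof. by move=> Bp i; rewrite coefN; apply: BN. Qed.
Let poXn n : poly_over B 'X^n.
Proof. by move=> i; rewrite coefXn; case: eqP. Qed.

Lemma adjoin_subalgebra : subalgebra (adjoin B x).
Proof.
split=> [a|_ _ [p Bp ->] [q Bq ->]|_ _ [p Bp ->] [q Bq ->]].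
- exists (a%:A)%:P; last by rewrite hornerC.
  by apply: poC; case: algB => + _ _; apply.
- by exists (p + q); [exact: poD | rewrite hornerD].
- by exists (p * q); [exact: poM | rewrite hornerM].
Qed.

Lemma sub_adjoin : B `<=` adjoin B x.
Proof. by move=> b Bb; exists b%:P; [exact: poC | rewrite hornerC]. Qed.

Lemma mem_adjoin : adjoin B x x.
Proof. by exists 'X => //; rewrite hornerX. Qed.

(** The coefficients in degree n of the elements of K that are polynomials of
    degree at most n in x: the leading coefficient ideals of the basis theorem,
    taken in the possibly non-free algebra B[x]. *)
Definition lead_coefs K n : set R :=
  [set b | exists p, [/\ poly_over B p, (size p <= n.+1)%N, p`_n = b & K p.[x]]].

Lemma lead_coefs_sub K n : lead_coefs K n `<=` B.
Proof. by move=> _ [p [Bp _ <- _]]. Qed.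

Lemma lead_coefs_submod K n :
  submod_over (adjoin B x) K -> submod_over B (lead_coefs K n).
Proof.
move=> [K0 KD KM]; split.
- by exists 0; rewrite size_poly0 coef0 horner0; split => // i; rewrite coef0.
- move=> _ _ [p [Bp sp <- Kp]] [q [Bq sq <- Kq]]; exists (p + q).
  split; [exact: poD| |by rewrite coefD|by rewrite hornerD; apply: KD].
  by apply: leq_trans (size_polyD _ _) _; rewrite geq_max sp.
- move=> b _ Bb [p [Bp sp <- Kp]]; exists (b%:P * p).
  split; [by apply: poM => //; apply: poC| |by rewrite coefCM|].
    by rewrite mul_polyC; apply: leq_trans (size_scale_leq _ _) sp.
  by rewrite hornerM hornerC; apply: KM => //; apply: sub_adjoin.
Qed.

Lemma lead_coefs_shift K n m :
  submod_over (adjoin B x) K -> (m <= n)%N ->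
  lead_coefs K m `<=` lead_coefs K n.
Proof.
move=> [_ _ KM] lemn _ [p [Bp sp <- Kp]]; exists (p * 'X^(n - m)); split.
- exact: poM.
- apply: leq_trans (size_polyMleq _ _) _.
  by rewrite size_polyXn addnS /= -[X in (_ <= X.+1)%N](subnKC lemn) -addSn leq_add2r.
- by rewrite coefMXn ltnNge leq_subr /= subKn.
- rewrite hornerM mulrC; apply: KM => //.
  by exists 'X^(n - m).
Qed.

(** The leading coefficient ideals increase with the degree and are constant
    from some N on. Elements of I whose leading coefficients generate those of
    degree at most N generate I, by descent on the degree. *)
Lemma adjoin_noetherian : noetherian_subring (adjoin B x).
Proof.
move=> I IC modI.
have fgL n := noeB (lead_coefs_sub (K := I) (n := n)) (lead_coefs_submod n modI).
pose U : set R := [set b | exists n, lead_coefs I n b].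
have UB : U `<=` B by move=> b [n /lead_coefs_sub].
have modU : submod_over B U.
  split; first by exists 0%N; case: (lead_coefs_submod 0 modI).
  - move=> b c [m Lb] [n Lc]; exists (maxn m n).
    case: (lead_coefs_submod (maxn m n) modI) => _ + _; apply.
      exact: (lead_coefs_shift modI (leq_maxl m n)).
    exact: (lead_coefs_shift modI (leq_maxr m n)).
  - move=> b c Bb [n Lc]; exists n.
    by case: (lead_coefs_submod n modI) => _ _; apply.
have [sU sUU genU] := noeB UB modU.
have [N LN] : exists N, forall b, b \in sU -> lead_coefs I N b.
  elim: sU sUU {genU} => [|b s IH] sU; first by exists 0%N.
  have [|N LN] := IH; first by move=> c cs; apply: sU; rewrite inE cs orbT.
  have [n Ln] := sU b (mem_head _ _); exists (maxn n N) => c.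
  rewrite inE => /orP[/eqP ->|/LN].
    exact: (lead_coefs_shift modI (leq_maxl n N)).
  exact: (lead_coefs_shift modI (leq_maxr n N)).
have fgL' n : exists s : seq R, (forall y, y \in s -> lead_coefs I n y) /\
    forall K, submod_over B K -> (forall y, y \in s -> K y) ->
      lead_coefs I n `<=` K.
  by have [s s1 s2] := fgL n; exists s.
have [gs gsP] := choice fgL'.
have UgN K : submod_over B K -> (forall b, b \in gs N -> K b) -> U `<=` K.
  move=> modK Kg; apply: genU => // b /LN.
  by have [_ +] := gsP N; apply.
have wit nb : exists p, nb.2 \in gs nb.1 ->
    [/\ poly_over B p, (size p <= nb.1.+1)%N, p`_nb.1 = nb.2 & I p.[x]].
  have [/(proj1 (gsP nb.1))[p Pp]|] := boolP (nb.2 \in gs nb.1); first by exists p.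
  by exists 0.
have [pol polP] := choice wit.
exists [seq (pol nb).[x] | nb <- [seq (n, b) | n <- iota 0 N.+1, b <- gs n]].
  move=> _ /mapP[_ /allpairsPdep[n [b [_ bn ->]]] ->].
  by have [] := polP (n, b) bn.
move=> K modK Kg y Iy; have [p Bp yp] := IC _ Iy; rewrite yp in Iy *.
have [n] := ubnP (size p); elim: n p Bp Iy {y yp} => // n IH p Bp Ip.
rewrite ltnS => sp; case: n IH sp => [_|n IH sp].
  rewrite leqn0 size_poly_eq0 => /eqP ->; rewrite horner0; by case: modK.
pose m := minn n N.
have [mn mN] : (m <= n)%N /\ (m <= N)%N by rewrite geq_minl geq_minr.
have modIK : submod_over (adjoin B x) (I `&` K).
  case: modI modK => [I0 ID IM] [K0 KD KM]; split=> //.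
    by move=> u v [Iu Ku] [Iv Kv]; split; [exact: ID|exact: KD].
  by move=> b u Bb [Iu Ku]; split; [exact: IM|exact: KM].
have gm b : b \in gs m -> lead_coefs (I `&` K) n b.
  move=> bm; apply: (lead_coefs_shift modIK mn).
  have [Bq sq qb Iq] := polP (m, b) bm.
  exists (pol (m, b)); split => //; split => //; apply: Kg.
  apply/map_f/allpairsPdep; exists m, b; split => //.
  by rewrite mem_iota /= ltnS.
have [q [Bq sq qp [Iq Kq]]] : lead_coefs (I `&` K) n p`_n.
  have modL := lead_coefs_submod n modIK.
  have Lp : lead_coefs I n p`_n by exists p.
  have [nN|Nn] := leqP n N.
    have mE : m = n by apply/minn_idPl.
    by rewrite mE in gm; have [_ /(_ _ modL gm _ Lp)] := gsP n.
  have mE : m = N by apply/minn_idPr/ltnW.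
  by rewrite mE in gm; apply: (UgN _ modL gm); exists n.
have pq : p = q + (p - q) by rewrite addrC subrK.
have Kpq : K (p - q).[x].
  apply: IH.
  - by apply: poD => //; apply: poN.
  - case: modI => _ ID IM; rewrite hornerD hornerN; apply: ID => //.
    rewrite -mulN1r; apply: IM => //; apply: sub_adjoin; exact: BN.
  - rewrite ltnS; apply/leq_sizeP => j.
    rewrite leq_eqVlt => /orP[/eqP <-|nj]; first by rewrite coefB qp subrr.
    by rewrite coefB !nth_default ?subrr //; apply: leq_trans nj.
by rewrite pq hornerD; case: modK => _ KD _; apply: KD.
Qed.

End Adjoin.

Lemma noetherian_scalars :
  noetherian A -> noetherian_subring [set y : R | exists a : A, y = a%:A].
Proof.
move=> noeA I IB [I0 ID IM].
pose IA : set A := [set a | I a%:A].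
have idIA : ideal IA.
  apply/submoduleP; split; first by rewrite /IA/= scale0r.
  move=> a b c Ib Ic; rewrite /IA/= scalerDl; apply: ID => //.
  have -> : (a *: b)%:A = a%:A * (b%:A) :> R by rewrite mulr_algl scalerA.
  by apply: IM => //; exists a.
have [n [g gE]] := noeA _ idIA.
have Ig i : IA (g i).
  rewrite gE; exists (fun j => (j == i)%:R) => //.
  rewrite (bigD1 i) //= eqxx scale1r big1 ?addr0 // => j /negbTE ->.
  by rewrite scale0r.
exists [seq (g i)%:A | i <- enum 'I_n].
  by move=> _ /mapP[i _ ->]; apply: Ig.
move=> K [K0 KD KM] Kg y Iy; have [a ya] := IB _ Iy; rewrite ya in Iy *.
have : IA a by []; rewrite gE => -[c _ <-].
rewrite scaler_suml; apply: (big_ind K) => // i _.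
have -> : (c i *: g i)%:A = (c i)%:A * (g i)%:A :> R by rewrite mulr_algl scalerA.
apply: KM; first by exists (c i).
by apply: Kg; apply/map_f; rewrite mem_enum.
Qed.

(** Hilbert's basis theorem, applied to the chain of subalgebras obtained by
    adjoining the generators one at a time. *)
Theorem finite_type_noetherian : noetherian A -> finite_type R -> noetherian R.
Proof.
move=> noeA [n [x xP]].
have [B [algB noeB Bx]] : exists B, [/\ subalgebra B, noetherian_subring B
    & forall i, B (x i)].
  suff H (s : seq R) : exists B, [/\ subalgebra B, noetherian_subring B
      & forall y, y \in s -> B y].
    have [B [algB noeB Bs]] := H [seq x i | i <- enum 'I_n].
    by exists B; split => // i; apply: Bs; apply/map_f; rewrite mem_enum.
  elim: s => [|y s [B [algB noeB Bs]]].
    exists [set y : R | exists a : A, y = a%:A]; split => //.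
      split=> [a|_ _ [a ->] [b ->]|_ _ [a ->] [b ->]]; first by exists a.
        by exists (a + b); rewrite scalerDl.
      by exists (a * b); rewrite mulr_algl scalerA.
    exact: noetherian_scalars.
  exists (adjoin B y); split.
  - exact: adjoin_subalgebra.
  - exact: adjoin_noetherian.
  - move=> z; rewrite inE => /orP[/eqP ->|/Bs]; first exact: mem_adjoin.
    exact: sub_adjoin.
have BT : B = setT.
  apply: xP => //; case: algB => BA BD BM; split.
  - by apply/asboolP; rewrite -(scale1r 1); apply: BA.
  - move=> a u v /asboolP Bu /asboolP Bv; apply/asboolP; apply: BD => //.
    by rewrite -mulr_algl; apply: BM.
  - by move=> u v /asboolP Bu /asboolP Bv; apply/asboolP; apply: BM.
move=> I idI; have [||s Is genI] := noeB I; first by rewrite BT.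
  case/idealP: idI => I0 ID IM; split => // b y _; exact: IM.
exists (size s), (fun i => s`_i); apply/seteqP; split; last first.
  move=> _ [a _ <-]; apply: ideal_sum => // i _; apply: idealMl => //.
  by apply: Is; apply: mem_nth.
apply: genI.
  split.
  - by exists (fun=> 0) => //; rewrite big1 // => i _; rewrite scale0r.
  - move=> _ _ [a _ <-] [b _ <-]; exists (fun i => a i + b i) => //.
    by rewrite -big_split /=; apply: eq_bigr => i _; rewrite scalerDl.
  - move=> b _ _ [a _ <-]; exists (fun i => b * a i) => //.
    by rewrite mulr_sumr; apply: eq_bigr => i _; symmetry; exact: mulrA.
move=> y /(nthP 0)[i si <-]; exists (fun j => (j == Ordinal si)%:R) => //.
rewrite (bigD1 (Ordinal si)) //= eqxx scale1r big1 ?addr0 // => j /negbTE ->.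
by rewrite scale0r.
Qed.

End HilbertBasis.

(** * Alternating forms *)

Definition upd (T : Type) (n : nat) (v : {ffun 'I_n -> T}) (i : 'I_n) (x : T)
    : {ffun 'I_n -> T} := finfun [eta v with i |-> x].

Section Update.
Variables (T : Type) (n : nat).
Implicit Types (v : {ffun 'I_n -> T}) (i j : 'I_n).

Lemma updE v i x j : upd v i x j = if j == i then x else v j.
Proof. by rewrite ffunE. Qed.

Lemma upd_same v i x : upd v i x i = x.
Proof. by rewrite updE eqxx. Qed.

Lemma upd_other v i x j : j != i -> upd v i x j = v j.
Proof. by rewrite updE => /negbTE ->. Qed.

Lemma upd_id v i : upd v i (v i) = v.
Proof. by apply/ffunP => j; rewrite updE; case: eqP => // ->. Qed.

Lemma updC v i j x y : i != j -> upd (upd v i x) j y = upd (upd v j y) i x.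
Proof.
move=> ij; apply/ffunP => k; rewrite !updE.
by case: eqP => [->|//]; rewrite eq_sym (negbTE ij).
Qed.

End Update.

Section Alternating.
Variables (R : comPzRingType) (M N : lmodType R) (n : nat).
Variable w : {ffun 'I_n -> M} -> N.
Hypothesis alt_w : alternating w.
Implicit Types (v : {ffun 'I_n -> M}) (i j : 'I_n).

Lemma alt_linear v i a x y :
  w (upd v i (a *: x + y)) = a *: w (upd v i x) + w (upd v i y).
Proof. exact: (proj1 alt_w). Qed.

Lemma alt_eq v i j : i != j -> v i = v j -> w v = 0.
Proof. exact: (proj2 alt_w). Qed.

Lemma altD v i x y : w (upd v i (x + y)) = w (upd v i x) + w (upd v i y).
Proof. by rewrite -{1}[x]scale1r alt_linear scale1r. Qed.

Lemma alt0 v i : w (upd v i 0) = 0.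
Proof. by apply: (@addrI _ (w (upd v i 0))); rewrite -altD !addr0. Qed.

Lemma altZ v i a x : w (upd v i (a *: x)) = a *: w (upd v i x).
Proof. by rewrite -[_ *: x]addr0 alt_linear alt0 addr0. Qed.

Lemma altN v i x : w (upd v i (- x)) = - w (upd v i x).
Proof. by rewrite -scaleN1r altZ scaleN1r. Qed.

Lemma altB v i x y : w (upd v i (x - y)) = w (upd v i x) - w (upd v i y).
Proof. by rewrite altD altN. Qed.

Lemma alt_dup v i j : i != j -> w (upd v i (v j)) = 0.
Proof.
move=> ij; apply: (alt_eq ij); rewrite upd_same upd_other // eq_sym.
exact: ij.
Qed.

Lemma alt_add_other v i j x c :
  i != j -> w (upd v i (x + c *: v j)) = w (upd v i x).
Proof. by move=> ij; rewrite altD altZ alt_dup // scaler0 addr0. Qed.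

Lemma alt_swap v i j x y :
  i != j -> w (upd (upd v i x) j y) = - w (upd (upd v i y) j x).
Proof.
move=> ij; apply/eqP; rewrite -addr_eq0.
have eq0 z : w (upd (upd v i z) j z) = 0.
  by apply: (alt_eq ij); rewrite upd_same upd_other ?upd_same.
have := eq0 (x + y); rewrite altD 2!(updC _ _ _ ij) !altD -!(updC _ _ _ ij).
by rewrite !eq0 add0r addr0 => /eqP; rewrite addrC.
Qed.

End Alternating.

(** The coordinates are changed one at a time; each change moves w by a multiple
    of c. *)
Lemma alt_cong (R : comNzRingType) (M : lmodType R) (n : nat)
    (w : {ffun 'I_n -> M} -> R^o) (I : set R) (c : R) (v y : {ffun 'I_n -> M}) :
  alternating w -> ideal I -> I c -> I (w (v + c *: y) - w v).
Proof.
move=> alt_w idI Ic.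
pose h k := [ffun i : 'I_n => if (i < k)%N then v i + c *: y i else v i].
have h0 : h 0%N = v by apply/ffunP => i; rewrite ffunE.
have hn : h n = v + c *: y by apply/ffunP => i; rewrite !ffunE ltn_ord.
suff H k : (k <= n)%N -> I (w (h k) - w (h 0%N)).
  by have := H n (leqnn n); rewrite hn h0.
elim: k => [_|k IH ltkn]; first by rewrite subrr; apply: ideal0.
have -> : h k.+1 = upd (h k) (Ordinal ltkn) (h k (Ordinal ltkn) + c *: y (Ordinal ltkn)).
  apply/ffunP => i; rewrite updE !ffunE ltnS leq_eqVlt /=.
  have [->|] := eqVneq i (Ordinal ltkn); first by rewrite /= eqxx ltnn.
  by rewrite -val_eqE /= => /negbTE ->.
rewrite altD // upd_id altZ // addrAC; apply: idealD => //.
  by apply: IH; apply: ltnW.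
exact: idealMr.
Qed.

(** * Volume forms of a module of constant rank *)

(** Restriction of scalars, needed because the universal property of exterior
    powers speaks of R-modules while determinants of localized coordinates live
    in a localization of R. *)
Definition restr (R Rp : comNzRingType) (loc : {rmorphism R -> Rp}) : Type := Rp.

Section RestrictScalars.
Variables (R Rp : comNzRingType) (loc : {rmorphism R -> Rp}).

HB.instance Definition _ := GRing.Zmodule.on (restr loc).

Definition restr_scale (a : R) (z : restr loc) : restr loc := loc a * (z : Rp).

Fact restr_scaleA a b z : restr_scale a (restr_scale b z) = restr_scale (a * b) z.
Proof. by rewrite /restr_scale rmorphM mulrA. Qed.
Fact restr_scale1 : left_id 1 restr_scale.
Proof. by move=> z; rewrite /restr_scale rmorph1 mul1r. Qed.
Fact restr_scaleDr : right_distributive restr_scale +%R.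
Proof. by move=> a x y; apply: mulrDr. Qed.
Fact restr_scaleDl z : {morph restr_scale^~ z : a b / a + b}.
Proof. by move=> a b; rewrite /restr_scale rmorphD mulrDl. Qed.

HB.instance Definition _ := GRing.Zmodule_isLmodule.Build R (restr loc)
  restr_scaleA restr_scale1 restr_scaleDr restr_scaleDl.

End RestrictScalars.

(** Cramer's rule: the coefficients are the entries of x times the adjugate. *)
Lemma det_upd_row (S : comNzRingType) n (V : 'I_n -> 'rV[S]_n) (x : 'rV[S]_n) :
  \det (\matrix_i V i) *: x =
  \sum_i \det (\matrix_k (if k == i then x else V k)) *: V i.
Proof.
pose A := \matrix_i V i.
have Ai i : row i A = V i by rewrite rowK.
have -> : \det A *: x = x *m \adj A *m A.
  by rewrite -mulmxA mul_adj_mx mul_mx_scalar.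
rewrite mulmx_sum_row; apply: eq_bigr => i _; rewrite Ai; congr (_ *: _).
rewrite mxE (expand_det_row _ i); apply: eq_bigr => j _.
rewrite !mxE eqxx; congr (_ * _).
rewrite /cofactor; congr (_ * \det _); apply/matrixP => k l; rewrite !mxE.
by rewrite eq_sym (negbTE (neq_lift _ _)).
Qed.

Section Volume.
Variables (R : comNzRingType) (P : lmodType R) (d : nat).
Variable w : {ffun 'I_d -> P} -> R^o.
Hypothesis alt_w : alternating w.
Hypothesis univ_w : forall (N : lmodType R) (f : {ffun 'I_d -> P} -> N),
  alternating f -> exists n0 : N, forall v, f v = w v *: n0.

Section AtPrime.
Variable p : set R.
Hypothesis hp : prime_ideal p.
Hypothesis rk : rank_at P p d.

(** After localization at p the determinant of coordinates is an alternating
    form, so a multiple of [w]; the multiplier is invertible since the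
    determinant takes an invertible value on P. *)
Lemma volume_local :
  (exists v, ~ p (w v)) /\
  forall v x, exists2 s, ~ p s &
    s *: (w v *: x - \sum_i w (upd v i x) *: v i) = 0.
Proof.
have [Rp [loc [Mp [mloc [[locU locF loc0] [mlocF mloc0] [phi bphi]]]]]] := rk.
pose psi x : 'rV[Rp]_d := phi (mloc x).
have psiP a x y : psi (a *: x + y) = loc a *: psi x + psi y.
  by rewrite /psi linearP /= linearP.
pose D (v : {ffun 'I_d -> P}) : restr loc := \det (\matrix_i psi (v i)).
have altD_ : alternating D.
  split=> [v i a x y|v i j ij vij]; last first.
    rewrite /D; apply: (determinant_alternate ij) => k.
    by rewrite !mxE vij.
  pose A z := \matrix_k psi (upd v i z k).
  have rowA z z' : row' i (A z) = row' i (A z').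
    apply/matrixP => j k; rewrite !mxE !updE.
    by rewrite eq_sym (negbTE (neq_lift _ _)).
  have := @determinant_multilinear _ _ (A (a *: x + y)) (A x) (A y) i (loc a) 1.
  rewrite mul1r; apply; rewrite ?(rowA _ (a *: x + y)) //.
  by apply/rowP => k; rewrite !mxE !updE eqxx psiP mul1r !mxE.
have [u Du] : exists u : Rp, forall v, D v = loc (w v) * u.
  by have [u Du] := univ_w altD_; exists u.
have [v0 Uv0] : exists v, (D v : Rp) \is a GRing.unit.
  have basis i : exists xs : P * R, ~ p xs.2 /\ psi xs.1 = loc xs.2 *: delta_mx 0 i.
    have [psi' phiK phiK'] := bphi.
    have [x [s ps E]] := mlocF (psi' (delta_mx 0 i)).
    exists (x, s); split => //=.
    rewrite -[delta_mx 0 i]phiK' E /psi linearZ /= scalerA divrr ?scale1r //.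
    exact: locU.
  have [xs xsP] := choice basis.
  exists [ffun i => (xs i).1]; rewrite /D.
  have -> : \matrix_i psi ([ffun i => (xs i).1] i) = diag_mx (\row_i loc (xs i).2).
    apply/matrixP => i j; rewrite !mxE ffunE (proj2 (xsP i)) !mxE eqxx /=.
    by rewrite eq_sym; case: eqP; rewrite ?mulr1 ?mulr0.
  rewrite det_diag; apply: (big_ind (fun z => z \is a GRing.unit)).
  - exact: unitr1.
  - by move=> y z Uy Uz; rewrite unitrMl.
  - by move=> i _; rewrite mxE; apply: locU; apply: (proj1 (xsP i)).
have Uu : u \is a GRing.unit by move: Uv0; rewrite Du unitrM => /andP[].
split=> [|v x].
  exists v0 => pw; move: Uv0; rewrite Du unitrM => /andP[Uw _].
  have [a [s ps E]] := locF (loc (w v0))^-1.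
  have [|t pt /eqP E'] := loc0 (w v0 * a - s).
    rewrite rmorphB rmorphM.
    have -> : loc a = (loc (w v0))^-1 * loc s by rewrite E divrK // locU.
    by rewrite mulrA divrr // mul1r subrr.
  move: E'; rewrite mulrBr subr_eq0 => /eqP E'.
  apply: (primeMN hp pt ps); rewrite -E'; apply: idealMl.
    exact: prime_is_ideal.
  by apply: idealMr => //; apply: prime_is_ideal.
apply: mloc0; apply: (bij_inj bphi); rewrite linear0 -/(psi _).
have psiZ a y : psi (a *: y) = loc a *: psi y.
  by rewrite /psi linearZ /= linearZ.
have psi_sum : psi (\sum_i w (upd v i x) *: v i) =
    \sum_i loc (w (upd v i x)) *: psi (v i).
  by rewrite /psi !linear_sum; apply: eq_bigr => i _; apply: psiZ.
have -> y z : psi (y - z) = psi y - psi z by rewrite /psi !linearB.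
rewrite psi_sum psiZ; set Z := (X in X = 0).
suff uZ : u *: Z = 0 by rewrite -[Z]scale1r -(mulVr Uu) -scalerA uZ scaler0.
rewrite /Z scalerBr scalerA mulrC -Du /D det_upd_row scaler_sumr -sumrB.
apply: big1 => i _; rewrite scalerA mulrC -Du.
apply/eqP; rewrite subr_eq0; apply/eqP; congr (\det _ *: _).
by apply/matrixP => j k; rewrite !mxE updE; case: eqP.
Qed.

End AtPrime.

(** Cramer's rule writes w(v) x as the combination of the v_j with coefficients
    w(v with x at j). Applying alpha, one of these coefficients is outside p, and
    a transposition brings x to the index i. *)
Lemma volume_extend (p : set R) (i : 'I_d) (alpha : {linear P -> R^o}) (x : P) :
  prime_ideal p -> rank_at P p d -> ~ p (alpha x) ->
  exists v, ~ p (w (upd v i x)).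
Proof.
move=> hp rk pax; apply: contrapT => noV.
have idp := prime_is_ideal hp.
have pw v j : p (w (upd v j x)).
  have [<-|ij] := eqVneq i j; first by apply: contrapT => h; apply: noV; exists v.
  have -> : upd v j x = upd (upd v i (v i)) j x by rewrite upd_id.
  rewrite alt_swap //; apply: idealN => //; apply: contrapT => h; apply: noV.
  by exists (upd v j (v i)); rewrite -updC.
have [[v pv] cram] := volume_local hp rk.
have [s ps E] := cram v x.
have {}E : s * (w v * alpha x) = s * \sum_j w (upd v j x) * alpha (v j).
  have lin : alpha (\sum_j w (upd v j x) *: v j) =
      \sum_j w (upd v j x) * alpha (v j).
    by rewrite linear_sum; apply: eq_bigr => j _; rewrite linearZ.
  have := congr1 alpha E; rewrite linear0 linearZ linearB linearZ lin /=.
  by move/eqP; rewrite scalerBr subr_eq0 => /eqP.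
apply: (primeMN hp ps (primeMN hp pv pax)); rewrite E.
by apply: idealMl => //; apply: ideal_sum => // j _; apply: idealMr.
Qed.

End Volume.

(** * Tuples of elements of P over a system of generators of J *)

Section Tuples.
Variables (R : comNzRingType) (P : lmodType R) (d : nat).
Hypothesis noeR : noetherian R.
Variable w : {ffun 'I_d -> P} -> R^o.
Hypothesis alt_w : alternating w.
Variable alpha : {linear P -> R^o}.
Implicit Types (p v z : {ffun 'I_d -> P}) (i j k : 'I_d) (u I : set R).

(** General position is achieved from the last vector downwards, so that the
    ideals cutting out smaller and smaller dimensions are the tails; the vectors
    of lowest index, which end up playing a special role, are left for later. *)
Definition tail p (n : nat) : set R :=
  gen [set x | exists2 i : 'I_d, (n <= i)%N & x = alpha (p i)].

Lemma tail_ideal p n : ideal (tail p n). Proof. exact: gen_ideal. Qed.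

Lemma mem_tail p n i : (n <= i)%N -> tail p n (alpha (p i)).
Proof. by move=> ni; apply: sub_gen; exists i. Qed.

Lemma tail_min p n I : ideal I ->
  (forall i, (n <= i)%N -> I (alpha (p i))) -> tail p n `<=` I.
Proof. by move=> idI Ip; apply: gen_min => // x [i ni ->]; apply: Ip. Qed.

Lemma preim_ideal I : ideal I -> submodule (alpha @^-1` I).
Proof. exact: (@preim_submodule _ _ R^o alpha). Qed.

Lemma preim_alt v i I : ideal I -> submodule [set x | I (w (upd v i x))].
Proof.
move=> idI; apply/submoduleP; split; rewrite /= ?alt0 //; first exact: ideal0.
by move=> a x y Ix Iy; rewrite /= alt_linear //; apply: idealD => //; apply: idealMl.
Qed.

Variable J : set R.
Hypothesis alphaJ : range alpha = J.
Hypothesis Jmax : forall q, prime_ideal q -> J `<=` q -> maxprime q.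

Lemma alpha_in x : J (alpha x). Proof. by rewrite -alphaJ; exists x. Qed.

(** One step of general position: the primes over the tail ideal that are not
    maximal do not contain J, hence are avoided by a suitable change of the
    vector p k by the previous ones. *)
Lemma cut_dimension p k : J `<=` tail p 0 -> dim_over (tail p k.+1) k.+1 ->
  exists p', [/\ w p' = w p, J `<=` tail p' 0 & dim_over (tail p' k) k].
Proof.
move=> Jp dimk.
have [L [L1 L2]] := primes_over noeR (tail_ideal p k.+1).
pose U := [seq q <- L | `[< ~ maxprime q >]].
pose Y : set P := span [set x | exists2 i : 'I_d, (i < k)%N & x = p i].
have sY : submodule Y by exact: span_submodule.
have UL q : q \in U -> q \in L by rewrite mem_filter => /andP[].
have Umax q : q \in U -> ~ maxprime q by rewrite mem_filter => /andP[/asboolP].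
have YI I : ideal I -> (forall i, (i < k)%N -> I (alpha (p i))) ->
    Y `<=` alpha @^-1` I.
  by move=> idI Ip; apply: span_min => [|_ [i ik ->]]; [exact: preim_ideal|exact: Ip].
have [||||y Yy goody] :=
  @general_position _ P Y U (fun q (z : P) => ~ q (alpha z)) (p k).
- exact: sY.
- by move=> q /UL/L1[].
- move=> q z c y /UL/L1[hq _] qc _ qz; rewrite linearD linearZ addrC => h.
  apply: qz; have idq := prime_is_ideal hq.
  exact: (idealDr idq (idealMr (alpha y) idq qc) h).
- move=> q z c qU Yz qc; have [hq tq] := L1 _ (UL _ qU).
  have idq := prime_is_ideal hq.
  have [qz|] := pselect (q (alpha z)); last first.
    by exists 0; [exact: submod0|rewrite scaler0 addr0].
  have [i ik qi] : exists2 i : 'I_d, (i < k)%N & ~ q (alpha (p i)).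
    apply: contrapT => noi; apply: (Umax _ qU); apply: Jmax => //.
    apply: subset_trans Jp _; apply: tail_min => // i _.
    have qlt j : (j < k)%N -> q (alpha (p j)).
      by move=> jk; apply: contrapT => qj; apply: noi; exists j.
    have [/qlt //|] := ltnP i k; rewrite leq_eqVlt => /orP[/eqP/val_inj <-|ki].
      have : q (alpha (z - p k)) by apply: (YI q).
      rewrite linearB => h; rewrite -[alpha (p k)](subKr (alpha z)).
      exact: idealB.
    by apply: tq; apply: mem_tail.
  exists (p i); first by apply: sub_span; exists i.
  rewrite linearD linearZ => h; have : q (c * alpha (p i)).
    exact: (idealDr idq qz h).
  exact: (primeMN hq).
pose p' := upd p k (p k + y).
have p'i i : i != k -> p' i = p i by move=> ik; rewrite /p' upd_other.
exists p'; split.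
- suff : Y `<=` [set y | forall x, w (upd p k (x + y)) = w (upd p k x)].
    by move/(_ _ Yy) => /(_ (p k)); rewrite upd_id.
  apply: span_min => [|_ [i ik ->] x].
    apply/submoduleP; split=> [x|a y1 y2 E1 E2 x]; first by rewrite addr0.
    rewrite addrA E2 altD // altZ //.
    have := E1 0; rewrite add0r alt0 // => ->; by rewrite scaler0 addr0.
  rewrite -[p i]scale1r alt_add_other //.
  by apply/eqP => ki; rewrite ki ltnn in ik.
- apply: subset_trans Jp _; apply: tail_min => [|i _]; first exact: tail_ideal.
  have [->|/p'i <-] := eqVneq i k; last exact: mem_tail.
  have h1 : tail p' 0 (alpha (p k + y)).
    by rewrite -(upd_same p k (p k + y)); apply: mem_tail.
  have h2 : tail p' 0 (alpha y).
    apply: (YI _ (tail_ideal p' 0) _ y Yy) => j jk; rewrite -p'i.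
      exact: mem_tail.
    by apply/eqP => E; rewrite E ltnn in jk.
  by rewrite -[p k](addrK y) linearB; exact: (idealB (tail_ideal p' 0) h1 h2).
- apply: (dim_over_cut (I := tail p k.+1) (L := L)) => //.
  + by move=> q /L1[].
  + by move=> q /L1[].
  + apply: tail_min => [|i ki]; first exact: tail_ideal.
    rewrite -p'i; first by apply: mem_tail; apply: ltnW.
    by apply/eqP => E; rewrite E ltnn in ki.
  + move=> q qL tq; apply: contrapT => qmax.
    have qU : q \in U by rewrite mem_filter qL andbT; apply/asboolP.
    apply: (goody q qU); apply: tq.
    by rewrite -(upd_same p k (p k + y)); apply: mem_tail.
Qed.

(** The vectors of index d - 1, d - 2, .., n are put in general position in turn. *)
Lemma general_generators p n : krull_dim_le R d -> J `<=` tail p 0 ->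
  (n <= d)%N -> exists2 p', J `<=` tail p' 0 & dim_over (tail p' n) n.
Proof.
move=> dimR Jp nd; rewrite -(subKn nd).
elim: (d - n)%N (leq_subr n d) => [_|m IH md].
  by exists p => // m c /dimR; rewrite subn0.
have [p' Jp' dimp'] := IH (ltnW md).
have kd : (d - m.+1 < d)%N by rewrite ltn_subrL (leq_trans _ md).
have [|p'' [_ Jp'' dimp'']] := @cut_dimension p' (Ordinal kd) Jp'.
  by rewrite /= subnSK.
by exists p''.
Qed.

(** The image of x under alpha is a combination of the alpha(p i), so x differs
    from the same combination of the p i by an element of the kernel. *)
Lemma tuple_ker_gen p (Y : set P) x : J `<=` tail p 0 -> submodule Y ->
  (forall i, Y (p i)) -> (forall y, alpha y = 0 -> Y y) -> Y x.
Proof.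
move=> Jp sY Yp Yk.
have [y Yy yx] : exists2 y, Y y & alpha y = alpha x.
  have: tail p 0 `<=` [set a | exists2 y, Y y & alpha y = a].
    apply: tail_min => [|i _]; last by exists (p i).
    apply/idealP; split.
    - by exists 0; [exact: submod0|rewrite linear0].
    - move=> _ _ [y Yy <-] [y' Yy' <-].
      by exists (y + y'); [exact: submodD|rewrite linearD].
    - by move=> a _ [y Yy <-]; exists (a *: y); [exact: submodZ|rewrite linearZ].
  by move=> h; exact: (h _ (Jp _ (alpha_in x))).
rewrite -[x](subrK y); apply: submodD => //; apply: Yk.
by rewrite linearB yx subrr.
Qed.

(** The vectors of a tuple with w nonzero at u are exchanged for vectors over
    the given generators, one at a time. A vector to be exchanged is a
    combination of the p j and of elements of the kernel of alpha, so one of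
    these can take its place with w still nonzero at u. If it is a kernel
    element x, then p i or p i + x can as well; if it is p j with j <> i, then
    either v j is exchanged instead, or v j - p j is a kernel element. *)
Lemma lift_at_prime p u v : J `<=` tail p 0 -> prime_ideal u -> ~ u (w v) ->
  exists2 y : {ffun 'I_d -> P}, (forall i, alpha (y i) = 0) & ~ u (w (p + y)).
Proof.
move=> Jp hu uv; have idu := prime_is_ideal hu.
pose bad v := [set i | alpha (v i) != alpha (p i)]%SET.
suff [v' v'p uv'] : exists2 v' : {ffun 'I_d -> P},
    (forall i, alpha (v' i) = alpha (p i)) & ~ u (w v').
  exists (v' - p); last by rewrite addrC subrK.
  by move=> i; rewrite !ffunE linearB v'p subrr.
have [n] := ubnP #|bad v|; elim: n v uv => // n IH v uv; rewrite ltnS => sz.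
have [/pred0P noi|] := boolP (pred0b [pred i | i \in bad v]).
  exists v => // i; apply/eqP; have := noi i; rewrite /= inE.
  by move/negbFE.
move/existsP => [i]; rewrite /= inE => bi.
have fin v' j : ~ u (w v') -> j \in bad v -> j \notin bad v' ->
    (forall l, l \in bad v' -> l \in bad v) -> exists2 v' : {ffun 'I_d -> P},
    (forall i, alpha (v' i) = alpha (p i)) & ~ u (w v').
  move=> uv' jv jv' sub; apply: (IH v' uv'); apply: leq_trans sz.
  apply: proper_card; apply/properP; split; last by exists j.
  exact/fintype.subsetP.
have done x : ~ u (w (upd v i x)) -> alpha x = alpha (p i) ->
    exists2 v' : {ffun 'I_d -> P},
    (forall i, alpha (v' i) = alpha (p i)) & ~ u (w v').
  move=> ux xi; apply: (fin _ i ux); first by rewrite inE.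
    by rewrite inE upd_same xi eqxx.
  by move=> l; rewrite !inE updE; have [->|] := eqVneq l i.
have ker x : ~ u (w (upd v i x)) -> alpha x = 0 -> exists2 v' : {ffun 'I_d -> P},
    (forall i, alpha (v' i) = alpha (p i)) & ~ u (w v').
  move=> ux x0; have [up|up] := pselect (u (w (upd v i (p i)))); last first.
    exact: (done _ up).
  apply: (done (p i + x)); last by rewrite linearD x0 addr0.
  rewrite altD // => h; apply: ux; exact: (idealDr idu up h).
have [|ukern] := pselect (exists2 x, ~ u (w (upd v i x)) & alpha x = 0).
  by case=> x; apply: ker.
have [j uj] : exists j, ~ u (w (upd v i (p j))).
  apply: contrapT => noj; apply: uv; rewrite -(upd_id v i).
  apply: (tuple_ker_gen (Y := [set x | u (w (upd v i x))]) _ Jp).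
  - exact: preim_alt.
  - by move=> j; apply: contrapT => uj; apply: noj; exists j.
  - by move=> x x0; apply: contrapT => ux; apply: ukern; exists x.
have [ji|ji] := eqVneq i j; first by apply: (done _ uj); rewrite ji.
have [jb|jb] := boolP (j \in bad v); last first.
  apply: (ker (v j - p j)); last first.
    by move: jb; rewrite inE negbK linearB => /eqP ->; rewrite subrr.
  by rewrite altB // alt_dup // sub0r => /(idealN idu); rewrite opprK.
apply: (fin (upd (upd v i (v j)) j (p j)) j) => //.
- by rewrite alt_swap // => /(idealN idu); rewrite opprK updC // upd_id.
- by rewrite inE upd_same eqxx.
- move=> l; rewrite !inE !updE; have [->|_] := eqVneq l j; first by rewrite eqxx.
  by have [->|] := eqVneq l i.
Qed.

(** The primes over J are finitely many and maximal, so the changes of p by the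
    kernel of alpha found at each of them can be combined; maximality makes the
    coefficients c invertible modulo u. *)
Lemma lift_generators p : ideal J -> J `<=` tail p 0 ->
  (forall u, prime_ideal u -> exists v, ~ u (w v)) ->
  exists p', (forall i, alpha (p' i) = alpha (p i)) /\
    forall u, prime_ideal u -> J `<=` u -> ~ u (w p').
Proof.
move=> idJ Jp nz; have [L [L1 L2]] := primes_over noeR idJ.
pose Y : set {ffun 'I_d -> P} := [set y | forall i, alpha (y i) = 0].
have sY : submodule Y.
  apply/submoduleP; split=> [i|a x y Yx Yy i]; first by rewrite ffunE linear0.
  by rewrite !ffunE linearP Yx Yy scaler0 addr0.
have [||||y Yy goody] :=
  @general_position _ _ Y L (fun u z => ~ u (w z)) p.
- exact: sY.
- by move=> u /L1[].
- move=> u z c y /L1[hu _] uc _ uz uzy; have idu := prime_is_ideal hu.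
  apply: uz; have := alt_cong z y alt_w idu uc => h.
  by rewrite -[w z](subKr (w (z + c *: y))); apply: idealB.
- move=> u z c /L1[hu Ju] Yz uc; have idu := prime_is_ideal hu.
  have zp i : alpha (z i) = alpha (p i).
    by apply/eqP; have := Yz i; rewrite !ffunE linearB => /eqP; rewrite subr_eq0.
  have [v uv] := nz u hu.
  have [|y Yy uy] := @lift_at_prime z u v _ hu uv.
    apply: subset_trans Jp _; apply: tail_min => [|i _]; first exact: tail_ideal.
    by rewrite -zp; apply: mem_tail.
  have [b ub] := maxprime_inv noeR hu (Jmax hu Ju) uc.
  exists (b *: y); first by move=> i; rewrite ffunE linearZ /= Yy scaler0.
  move=> h; apply: uy.
  have E : z + c *: (b *: y) = z + y + (b * c - 1) *: y.
    by rewrite scalerA scalerBl scale1r [c * b]mulrC -addrA [y + _]addrC subrK.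
  have ubc : u (b * c - 1) by rewrite -opprB; apply: idealN.
  have := alt_cong (z + y) y alt_w idu ubc; rewrite -E => h'.
  by rewrite -[w (z + y)](subKr (w (z + c *: (b *: y)))); apply: idealB.
exists (p + y); split; first by move=> i; rewrite ffunE linearD Yy addr0.
move=> u hu Ju; have [q qL qu] := L2 u hu Ju.
by have [hq Jq] := L1 q qL; move=> /(Jmax hq Jq hu qu); apply: goody.
Qed.

End Tuples.

(** * Completing vectors to a basis over a base of dimension one *)

Section Frames.
Variables (R : comNzRingType) (P : lmodType R) (d : nat).
Hypothesis noeR : noetherian R.
Variable w : {ffun 'I_d -> P} -> R^o.
Hypothesis alt_w : alternating w.
Implicit Types (X z : {ffun 'I_d -> P}) (i j : 'I_d) (u I : set R) (x y : P).

(** Linear independence of the first n vectors of X in the fibre of P at the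
    prime u: since w spans the alternating forms, it amounts to the existence of
    a completion to a tuple on which w does not vanish at u. *)
Definition indep u (n : nat) X : Prop :=
  exists2 z : {ffun 'I_d -> P}, (forall j, (j < n)%N -> z j = X j) & ~ u (w z).

Lemma indep_updP u i X x : indep u i.+1 (upd X i x) <->
  exists2 z : {ffun 'I_d -> P}, (forall j, (j < i)%N -> z j = X j) & ~ u (w (upd z i x)).
Proof.
split=> -[z zX uz]; [exists z|exists (upd z i x)] => //.
- move=> j ji; rewrite zX ?upd_other //; last exact: ltnW.
  by apply/eqP => E; rewrite E ltnn in ji.
- by rewrite -(upd_same X i x) -zX // upd_id.
- move=> j; rewrite ltnS leq_eqVlt => /orP[/eqP/val_inj ->|ji].
    by rewrite !upd_same.
  have ne : j != i by apply/eqP => E; rewrite E ltnn in ji.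
  by rewrite !upd_other // zX.
Qed.

Lemma indep_move u i X x y c : prime_ideal u -> ~ u c ->
  ~ indep u i.+1 (upd X i x) -> indep u i.+1 (upd X i y) ->
  indep u i.+1 (upd X i (x + c *: y)).
Proof.
move=> hu uc ux /indep_updP[z zX uz]; apply/indep_updP; exists z => //.
rewrite altD // altZ // => h; have uzx : u (w (upd z i x)).
  by apply: contrapT => uzx; apply: ux; apply/indep_updP; exists z.
have : u (c * w (upd z i y)) by exact: (idealDr (prime_is_ideal hu) uzx h).
exact: (primeMN hu).
Qed.

Lemma indep_stable u i X x y c : prime_ideal u -> u c ->
  indep u i.+1 (upd X i x) -> indep u i.+1 (upd X i (x + c *: y)).
Proof.
move=> hu uc /indep_updP[z zX uz]; apply/indep_updP; exists z => //.
rewrite altD // altZ // addrC => h; apply: uz; have idu := prime_is_ideal hu.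
exact: (idealDr idu (idealMr (w (upd z i y)) idu uc) h).
Qed.

Lemma indep_extend u i X : indep u i X -> exists y, indep u i.+1 (upd X i y).
Proof. by move=> [z zX uz]; exists (z i); apply/indep_updP; exists z; rewrite ?upd_id. Qed.

(** If x and y are independent modulo the predecessors, so is every x + c y; the
    vector y is used to complete. *)
Lemma indep_combine u i j X x y c : j = i.+1 :> nat ->
  indep u j.+1 (upd (upd X i x) j y) -> indep u i.+1 (upd X i (x + c *: y)).
Proof.
move=> ji /indep_updP[z zX uz]; have ij : i != j.
  by apply/eqP => E; move: ji; rewrite E => /n_Sn.
apply/indep_updP; exists (upd z j y).
  move=> l li; have lj : (l < j)%N by rewrite ji ltnW.
  rewrite upd_other; last by apply/eqP => E; rewrite E ltnn in lj.
  by rewrite zX // upd_other //; apply/eqP => E; rewrite E ltnn in li.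
have zi : z i = x by rewrite zX ?ji // upd_same.
have -> : w (upd (upd z j y) i (x + c *: y)) = w (upd (upd z j y) i x).
  by rewrite -{2}(upd_same z j y) alt_add_other.
by rewrite -updC // -zi upd_id.
Qed.

Lemma indep_shift u i j X x c : (j < i)%N ->
  indep u i.+1 (upd X i x) -> indep u i.+1 (upd X i (x + c *: X j)).
Proof.
move=> ji /indep_updP[z zX uz]; apply/indep_updP; exists z => //.
rewrite -zX // alt_add_other //.
by apply/eqP => E; rewrite E ltnn in ji.
Qed.

(** The prefix to be extended, its length included, may vary with the prime. *)
Lemma generic_extension (U : seq (set R)) (pos : set R -> 'I_d)
    (F : set R -> {ffun 'I_d -> P}) (x : P) (h : R) :
  (forall u, u \in U -> [/\ prime_ideal u, ~ u h & indep u (pos u) (F u)]) ->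
  exists y, forall u, u \in U ->
    indep u (pos u).+1 (upd (F u) (pos u) (x + h *: y)).
Proof.
move=> hU; pose Y : set P := [set y | exists y', y = h *: y'].
have sY : submodule Y.
  apply/submoduleP; split; first by exists 0; rewrite scaler0.
  move=> a _ _ [y ->] [y' ->]; exists (a *: y + y').
  by rewrite scalerDr !scalerA mulrC.
have [||||_ [y ->] goody] := @general_position _ P Y U
  (fun u (z : P) => indep u (pos u).+1 (upd (F u) (pos u) z)) x.
- exact: sY.
- by move=> u /hU[].
- by move=> u z c y /hU[hu _ _] uc _; apply: indep_stable.
- move=> u z c /hU[hu uh] /indep_extend[y uy] _ uc.
  have [uz|uz] := pselect (indep u (pos u).+1 (upd (F u) (pos u) z)).
    by exists 0; [exact: submod0|rewrite scaler0 addr0].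
  exists (h *: y); first by exists y.
  by rewrite scalerA; apply: indep_move => //; apply: primeMN.
by exists y.
Qed.

Variables (I : set R) (h : R).
Hypotheses (idI : ideal I) (dimI : dim_over I 1).

(** The locus where x depends on the vectors of X before i is closed. If it
    contains no minimal prime over I outside V(h), then dimension one makes it
    consist, outside V(h), of finitely many maximal ideals. *)
Lemma dependency_locus (L : seq (set R)) i X x :
  (forall p, p \in L -> prime_ideal p /\ I `<=` p) ->
  (forall q, prime_ideal q -> I `<=` q -> exists2 p, p \in L & p `<=` q) ->
  (forall p, p \in L -> ~ p h -> indep p i.+1 (upd X i x)) ->
  exists L' : seq (set R),
    (forall u, u \in L' -> [/\ prime_ideal u, I `<=` u, maxprime u, ~ u h
      & ~ indep u i.+1 (upd X i x)]) /\
    (forall q, prime_ideal q -> I `<=` q -> ~ q h ->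
      ~ indep q i.+1 (upd X i x) -> q \in L').
Proof.
move=> L1 L2 Lx.
pose D := gen (I `|` [set a | exists2 z : {ffun 'I_d -> P},
  (forall j, (j < i)%N -> z j = X j) & a = w (upd z i x)]).
have Ddep u : D `<=` u -> ~ indep u i.+1 (upd X i x).
  move=> Du /indep_updP[z zX]; apply; apply: Du; apply: sub_gen; right.
  by exists z.
have depD u : prime_ideal u -> I `<=` u -> ~ indep u i.+1 (upd X i x) -> D `<=` u.
  move=> hu Iu ux; apply: gen_min; first exact: prime_is_ideal.
  move=> a [/Iu //|[z zX ->]]; apply: contrapT => uz; apply: ux.
  by apply/indep_updP; exists z.
have [LD [LD1 LD2]] := primes_over noeR (gen_ideal _ : ideal D).
have ID : I `<=` D by move=> a Ia; apply: sub_gen; left.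
have maxLD u : u \in LD -> ~ u h -> maxprime u.
  move=> /LD1[hu Du] uh; have [p pL pu] := L2 u hu (subset_trans ID Du).
  have [hp Ip] := L1 p pL.
  apply: (dim_over1_max dimI hp hu Ip pu) => up.
  have ph : ~ p h by move/pu.
  exact: (Ddep p (subset_trans Du up) (Lx p pL ph)).
exists [seq u <- LD | `[< ~ u h >]]; split.
  move=> u; rewrite mem_filter => /andP[/asboolP uh uL].
  have [hu Du] := LD1 u uL; split => //; [exact: subset_trans Du|exact: maxLD|].
  exact: Ddep.
move=> q hq Iq qh qx; have [u uL uq] := LD2 q hq (depD q hq Iq qx).
have uh : ~ u h by move/uq.
have <- : u = q by apply/seteqP; split => //; apply: (maxLD u uL uh q hq).
by rewrite mem_filter uL andbT; apply/asboolP.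
Qed.

(** With room for two more vectors, X i can be changed modulo h so as to become
    independent of its predecessors everywhere. A first change makes it
    independent at the generic points, so that bad primes are finitely many
    maximal ideals; a second vector y2, independent of the predecessors at
    these and of X i generically, is then added with a coefficient that is
    invertible at the bad primes and vanishes at the finitely many primes where
    the sum could degenerate. *)
Lemma extend_frame X i j : j = i.+1 :> nat ->
  (forall u, prime_ideal u -> I `<=` u -> indep u i X) ->
  (forall u, prime_ideal u -> I `<=` u -> u h -> indep u i.+1 X) ->
  exists y, forall u, prime_ideal u -> I `<=` u ->
    indep u i.+1 (upd X i (X i + h *: y)).
Proof.
move=> ji indX indXh.
have [L [L1 L2]] := primes_over noeR idI.
pose U := [seq u <- L | `[< ~ u h >]].
have UP u : u \in U -> [/\ prime_ideal u, I `<=` u & ~ u h].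
  by rewrite mem_filter => /andP[/asboolP uh /L1[hu Iu]].
have LU u : u \in L -> ~ u h -> u \in U.
  by move=> uL uh; rewrite mem_filter uL andbT; apply/asboolP.
have [|y1 Uy1] := @generic_extension U (fun=> i) (fun=> X) (X i) h.
  by move=> u /UP[hu Iu uh]; split => //; apply: indX.
pose x := X i + h *: y1.
have [|L' [L'1 L'2]] := @dependency_locus L i X x L1 L2.
  by move=> p pL ph; apply/Uy1/LU.
pose good u := `[< indep u i.+1 (upd X i x) >].
have [|y2 Uy2] := @generic_extension (L' ++ U) (fun u => if good u then j else i)
    (fun u => if good u then upd X i x else X) 0 1.
  move=> u uL; have [hu Iu] : prime_ideal u /\ I `<=` u.
    by move: uL; rewrite mem_cat => /orP[/L'1[]|/UP[]].
  split => //; first exact: prime1.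
  rewrite /good; case: asboolP => [|_]; first by rewrite ji.
  exact: indX.
have y2E : 0 + 1 *: y2 = y2 by rewrite add0r scale1r.
have [|L'' [L''1 L''2]] := @dependency_locus L j (upd X i x) y2 L1 L2.
  move=> p pL ph; have pU := LU p pL ph.
  have gp : good p by apply/asboolP/Uy1.
  have := Uy2 p; rewrite mem_cat pU orbT => /(_ isT).
  by rewrite gp y2E.
have [|||c [Tc Uc]] := @avoid_primes _ [seq u <- L'' | good u] L'.
- by move=> t; rewrite mem_filter => /andP[_ /L''1[/prime_is_ideal]].
- by move=> u /L'1[].
- move=> t u; rewrite mem_filter => /andP[/asboolP gt /L''1[ht _ maxt _ _]].
  move=> /L'1[hu _ _ _ du] tu; apply: du.
  by have -> : u = t by apply/seteqP; split => //; apply: maxt.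
exists (y1 + c *: y2) => u hu Iu.
have [uh|uh] := pselect (u h).
  by apply: indep_stable => //; rewrite upd_id; apply: indXh.
rewrite scalerDr addrA -/x scalerA.
have [xu|xu] := pselect (indep u i.+1 (upd X i x)); last first.
  have uL := L'2 u hu Iu uh xu; apply: indep_move => //.
    by apply: primeMN => //; apply: Uc.
  have := Uy2 u; rewrite mem_cat uL => /(_ isT).
  by rewrite y2E /good; case: asboolP.
have [yu|yu] := pselect (indep u j.+1 (upd (upd X i x) j y2)).
  exact: indep_combine yu.
apply: indep_stable => //; apply: idealMl; first exact: prime_is_ideal.
apply: Tc; rewrite mem_filter L''2 // andbT; exact/asboolP.
Qed.

End Frames.

Section UnimodularForm.
Variables (R : comNzRingType) (P : lmodType R) (d : nat).
Hypothesis noeR : noetherian R.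
Hypothesis d2 : (2 <= d)%N.
Variable w : {ffun 'I_d -> P} -> R^o.
Hypothesis alt_w : alternating w.
Variable alpha : {linear P -> R^o}.
Hypothesis ext : forall u i x, prime_ideal u -> ~ u (alpha x) ->
  exists v : {ffun 'I_d -> P}, ~ u (w (upd v i x)).
Variable J : set R.
Hypothesis idJ : ideal J.
Hypothesis alphaJ : range alpha = J.

Variables (p : {ffun 'I_d -> P}) (i0 : 'I_d).
Hypothesis i00 : i0 = 0%N :> nat.
Hypothesis Jp : J `<=` tail alpha p 0.
Hypothesis dimp : dim_over (tail alpha p 1) 1.
Hypothesis wp : J (w p - 1).

Let I := tail alpha p 1.
Let h : R := alpha (p i0).

Let idI : ideal I. Proof. exact: tail_ideal. Qed.

Let gt0 (i : 'I_d) : i != i0 -> (0 < i)%N.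
Proof. by rewrite lt0n -val_eqE /= i00. Qed.

Let tail_split : tail alpha p 0 `<=` gen (I `|` [set h]).
Proof.
apply: tail_min => [|i _]; first exact: gen_ideal.
apply: sub_gen; have [->|/gt0 i_gt0] := eqVneq i i0; first by right.
by left; apply: mem_tail.
Qed.

Let alphaJx x : J (alpha x). Proof. by rewrite -alphaJ; exists x. Qed.

Let hC (a : R) : h *: (a : R^o) = a *: (h : R^o).
Proof. exact: mulrC. Qed.

(** Vectors are changed by the elements h y - alpha(y) X_0 of the kernel of
    alpha. As X_0 comes first, this amounts to adding h y, both for w and for
    independence. The start uses that alpha(X_0) = h: where h does not vanish,
    neither does X_0, and where h vanishes w X is 1. *)
Lemma frames n : (0 < n)%N -> (n < d)%N -> exists X : {ffun 'I_d -> P},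
  [/\ forall i, alpha (X i) = alpha (p i), J (w X - 1)
    & forall u, prime_ideal u -> I `<=` u -> indep w u n X].
Proof.
case: n => // n _; elim: n => [_|n IH nd].
  exists p; split => // u hu Iu; have [uh|uh] := pselect (u h).
    exists p => // up; apply: (prime1 hu); have idu := prime_is_ideal hu.
    rewrite -(subKr (w p) 1); apply: idealB => //.
    suff Ju : J `<=` u by apply: Ju.
    apply: subset_trans Jp _; apply: subset_trans tail_split _.
    by apply: gen_min => // a [/Iu //|->].
  have [v uv] := ext i0 hu uh; exists (upd v i0 (p i0)) => // j.
  rewrite ltnS leqn0 => /eqP j0.
  have -> : j = i0 by apply/val_inj; rewrite /= j0 i00.
  by rewrite upd_same.
have [X [alX wX indX]] := IH (ltnW nd).
pose i := Ordinal (ltnW nd); pose j := Ordinal nd.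
have [u hu Iu uh|y indy] := @extend_frame _ _ _ noeR _ alt_w I h idI dimp X i j erefl indX.
  exists X => // uX; have idu := prime_is_ideal hu; apply: (prime1 hu).
  rewrite -(subKr (w X) 1); apply: idealB => //.
  suff Ju : J `<=` u by apply: Ju.
  apply: subset_trans Jp _; apply: subset_trans tail_split _.
  by apply: gen_min => // a [/Iu //|->].
have ii0 : i != i0 by rewrite -val_eqE /= i00.
exists (upd X i (X i + h *: y - alpha y *: X i0)); split.
- move=> k; rewrite updE; case: eqP => [->|_ //].
  by rewrite linearB linearD !linearZ /= !alX -/h hC scalerN addrK.
- rewrite -scaleNr alt_add_other // altD // upd_id altZ // addrAC.
  by apply: idealD => //; apply: idealMr => //; apply: alphaJx.
- move=> u hu Iu; rewrite -scaleNr.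
  have i0i : (i0 < i)%N by rewrite i00.
  exact: (indep_shift alt_w (- alpha y) i0i (indy u hu Iu)).
Qed.

(** The first d - 1 vectors being independent over I, the value of w as a
    function of the last vector is onto R / I. As w X is 1 modulo J = I + (h)
    already, a multiple of h is enough to make it 1 modulo I. *)
Lemma unimodular_tuple : exists X : {ffun 'I_d -> P},
  (forall i, alpha (X i) = alpha (p i)) /\ I (w X - 1).
Proof.
have d1 : (d.-1 < d)%N by rewrite prednK // ltnW.
have d10 : (0 < d.-1)%N by rewrite -ltnS prednK // ltnW.
have [X [alX wX indX]] := frames d10 d1.
pose i : 'I_d := Ordinal d1.
have ii0 : i != i0 by rewrite -val_eqE /= i00 -lt0n.
pose K : set R := [set x | exists2 a, I a & exists y, x = a + w (upd X i y)].
have idK : ideal K.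
  apply/idealP; split.
  - by exists 0; [exact: ideal0|exists 0; rewrite alt0 // addr0].
  - move=> _ _ [a Ia [y ->]] [b Ib [z ->]]; exists (a + b).
      exact: (idealD idI Ia Ib).
    by exists (y + z); rewrite altD // addrACA.
  - move=> c _ [a Ia [y ->]]; exists (c * a).
      exact: (idealMl c idI Ia).
    by exists (c *: y); rewrite altZ // mulrDr.
have [a Ia [y E]] : K 1.
  apply: ideal_no_prime => // u hu Ku.
  have Iu : I `<=` u.
    move=> a Ia; apply: Ku; exists a => //; exists 0.
    by rewrite alt0 // addr0.
  have [z zX] := indX u hu Iu; apply; apply: Ku.
  exists 0; first exact: ideal0.
  exists (z i); rewrite add0r; congr w; apply/ffunP => k; rewrite updE.
  case: (eqVneq k i) => [-> //|ki]; rewrite zX //.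
  have kd : (k <= d.-1)%N by rewrite -ltnS prednK // ltnW.
  by rewrite ltn_neqAle kd andbT; move: ki; rewrite -val_eqE.
have [b Ib [r Er]] : exists2 b, I b & exists r, 1 - w X = b + r * h.
  apply: gen_add1 => //; apply: tail_split; apply: Jp.
  by rewrite -opprB; apply: idealN.
exists (upd X i (X i + r *: (h *: y - alpha y *: X i0))); split.
  move=> k; rewrite updE; case: eqP => [->|_ //].
  rewrite linearD linearZ linearB !linearZ /= !alX -/h hC ?scalerN subrr.
  by rewrite scaler0 addr0.
rewrite scalerBr !scalerA addrA -scaleNr alt_add_other //.
rewrite altD // upd_id altZ //.
have -> : w X = 1 - (b + r * h) by rewrite -Er opprB addrC subrK.
have -> : w (upd X i y) = 1 - a by rewrite E addrC addKr.
have -> : 1 - (b + r * h) + (r * h) *: ((1 - a) : R^o) - 1 = - b - (r * h) * a.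
  rewrite /GRing.scale /=; ring.
exact: (idealB idI (idealN idI Ib) (idealMl _ idI Ia)).
Qed.

(** The form alpha + (1 - h) w(-, X_1, ..) takes the values alpha(X_i) at the
    X_i with i > 0, and 1 at X_0 modulo these. *)
Lemma unimodular_form : exists phi : {linear P -> R^o}, exists e, phi e = 1.
Proof.
have [X [alX wX]] := unimodular_tuple.
pose f (x : P) : R^o := alpha x + (1 - h) *: w (upd X i0 x).
have lin : linear f.
  move=> a x y; rewrite /f linearP alt_linear // !scalerDr !scalerA mulrC.
  by rewrite addrACA.
pose phi : {linear P -> R^o} := HB.pack f (GRing.isLinear.Build _ _ _ _ f lin).
exists phi.
pose K : set R := [set x | exists e, phi e = x].
have idK : ideal K.
  apply/idealP; split; first by exists 0; rewrite linear0.
    by move=> _ _ [x <-] [y <-]; exists (x + y); rewrite linearD.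
  by move=> a _ [x <-]; exists (a *: x); rewrite linearZ.
have IK : I `<=` K.
  apply: tail_min => // i i_gt0; exists (X i).
  have ne : i0 != i by apply/eqP => E; rewrite -E i00 in i_gt0.
  by rewrite /phi /= /f alt_dup // scaler0 addr0.
have K1 : K (phi (X i0)) by exists (X i0).
have E : phi (X i0) = 1 + (1 - h) * (w X - 1).
  by rewrite /phi /= /f upd_id alX -/h /GRing.scale /=; ring.
have : K 1; last by [].
have -> : (1 : R) = phi (X i0) - (1 - h) * (w X - 1) by rewrite E addrK.
by apply: idealB => //; apply: idealMl => //; apply: IK.
Qed.

End UnimodularForm.

(** * Quotient algebras *)

Section QuotientAlgebra.
Variables (A : comPzRingType) (R : comAlgType A) (I : set R).

(** The proofs that I is an ideal and proper are arguments, so that the quotient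
    structures can be found from the predicate alone. *)
Definition quot_pred of ideal I & ~ I 1 : R -> bool := fun x => `[< I x >].

Variables (idI : ideal I) (I1 : ~ I 1).

Fact quot_pred_ideal : idealr_closed (quot_pred idI I1).
Proof.
have qP x : reflect (I x) (x \in quot_pred idI I1) by exact: asboolP.
have q0 : I 0 := ideal0 idI.
split; [exact/qP|by apply/qP|move=> a x y /qP Ix /qP Iy; apply/qP].
by apply: idealD => //; apply: idealMl.
Qed.

HB.instance Definition _ := isIdealr.Build R (quot_pred idI I1) quot_pred_ideal.

Definition quot_idealr : idealr R := quot_pred idI I1.

Definition quot_alg : Type := {ideal_quot quot_idealr}.

HB.instance Definition _ := GRing.ComNzRing.on quot_alg.

Definition quot_pi (x : R) : quot_alg := \pi_({ideal_quot quot_idealr})%qT x.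

Lemma quot_pi_surj (y : quot_alg) : exists x, quot_pi x = y.
Proof. by exists (repr y); rewrite /quot_pi reprK. Qed.

Fact quot_pi_zmod : zmod_morphism quot_pi.
Proof. by move=> x y; rewrite /quot_pi rmorphB. Qed.

Fact quot_pi_monoid : monoid_morphism quot_pi.
Proof. by split=> [|x y]; rewrite /quot_pi ?rmorph1 ?rmorphM. Qed.

HB.instance Definition _ := GRing.isZmodMorphism.Build R quot_alg quot_pi quot_pi_zmod.
HB.instance Definition _ := GRing.isMonoidMorphism.Build R quot_alg quot_pi quot_pi_monoid.

Lemma quot_pi0 x : quot_pi x = 0 <-> I x.
Proof.
have E : (x \in quot_idealr) = (quot_pi x == quot_pi 0).
  by rewrite -[x in LHS]subr0; apply: Quotient.idealrBE.
have -> : (0 : quot_alg) = quot_pi 0 by rewrite rmorph0.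
by split=> [/eqP|Ix]; [rewrite -E => /asboolP|apply/eqP; rewrite -E; apply/asboolP].
Qed.

Definition quot_scale (a : A) (y : quot_alg) : quot_alg := quot_pi a%:A * y.

Fact quot_scaleA a b y : quot_scale a (quot_scale b y) = quot_scale (a * b) y.
Proof.
by rewrite /quot_scale mulrA -rmorphM mulr_algl scalerA.
Qed.
Fact quot_scale1 : left_id 1 quot_scale.
Proof. by move=> y; rewrite /quot_scale scale1r rmorph1 mul1r. Qed.
Fact quot_scaleDr : right_distributive quot_scale +%R.
Proof. by move=> a x y; apply: mulrDr. Qed.
Fact quot_scaleDl y : {morph quot_scale^~ y : a b / a + b}.
Proof. by move=> a b; rewrite /quot_scale scalerDl rmorphD mulrDl. Qed.

HB.instance Definition _ := GRing.Zmodule_isLmodule.Build A quot_alg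
  quot_scaleA quot_scale1 quot_scaleDr quot_scaleDl.

Fact quot_scaleAl a (x y : quot_alg) : a *: (x * y) = (a *: x) * y.
Proof. exact: mulrA. Qed.

HB.instance Definition _ := GRing.Lmodule_isLalgebra.Build A quot_alg quot_scaleAl.
HB.instance Definition _ := GRing.Lalgebra_isComAlgebra.Build A quot_alg.

Lemma quot_piZ a x : quot_pi (a *: x) = a *: quot_pi x.
Proof. by rewrite -mulr_algl rmorphM. Qed.

Lemma quot_finite_type : finite_type R -> finite_type (quot_alg : comAlgType A).
Proof.
move=> [n [x xP]]; exists n, (fun i => quot_pi (x i)) => T [T1 TZ TM] Tx.
apply/seteqP; split => // y _; have [z <-] := quot_pi_surj y.
suff E : quot_pi @^-1` T = setT by have : (quot_pi @^-1` T) z by rewrite E.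
have TP y' : T y' <-> (y' \in (mem T : {pred quot_alg})) by split=> /asboolP.
apply: xP => //; split.
- by apply/asboolP; rewrite /preimage /= rmorph1; apply/TP.
- move=> a u v /asboolP Tu /asboolP Tv; apply/asboolP.
  by rewrite /preimage /= rmorphD /= quot_piZ; apply/TP/TZ; apply/TP.
- move=> u v /asboolP Tu /asboolP Tv; apply/asboolP.
  by rewrite /preimage /= rmorphM; apply/TP/TM; apply/TP.
Qed.

Lemma quot_dim n : dim_over I n -> krull_dim_le (quot_alg : comNzRingType) n.
Proof.
move=> dimI m c [hc ltc].
apply: (dimI m (fun i => quot_pi @^-1` c i)); last first.
  move=> x /quot_pi0; rewrite /preimage /= => ->.
  have id0 := prime_is_ideal (hc 0%N (leq0n m)).
  have h := ideal0 id0. exact: h.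
split=> [i /hc hci|i /ltc[cc ncc]].
  have idc := prime_is_ideal hci.
  apply/prime_idealP; split; [apply/idealP; split| |].
  - by rewrite /preimage /= rmorph0; apply: ideal0.
  - by move=> x y cx cy; rewrite /preimage /= rmorphD; apply: idealD.
  - by move=> a x cx; rewrite /preimage /= rmorphM; apply: idealMl.
  - by rewrite /preimage /= rmorph1; apply: prime1.
  - by move=> x y; rewrite /preimage /= rmorphM; apply: primeM.
split=> [x|sub]; first exact: cc.
apply: ncc => y; have [x <-] := quot_pi_surj y; exact: sub.
Qed.

End QuotientAlgebra.

(** * Kernels of linear forms *)

Section Kernel.
Variables (R : pzRingType) (V W : lmodType R) (f : {linear V -> W}).

Definition ker_pred : {pred V} := fun v => f v == 0.

Lemma ker_predE v : (v \in ker_pred) = (f v == 0). Proof. by []. Qed.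

Fact ker_pred_submod : submod_closed ker_pred.
Proof.
split=> [|a u v]; rewrite !ker_predE ?linear0 // => /eqP fu /eqP fv.
by rewrite linearP fu fv scaler0 addr0.
Qed.

HB.instance Definition _ := GRing.isSubmodClosed.Build R V ker_pred ker_pred_submod.

Definition kernel : Type := {v : V | v \in ker_pred}.

HB.instance Definition _ := SubType.copy kernel {v : V | v \in ker_pred}.
HB.instance Definition _ := [Choice of kernel by <:].
HB.instance Definition _ := [SubChoice_isSubLmodule of kernel by <:].

Lemma kernelP (v : kernel) : f (val v) = 0.
Proof. by apply/eqP; rewrite -ker_predE; apply: valP. Qed.

Lemma kernel_intro v : f v = 0 -> exists u : kernel, val u = v.
Proof.
move=> fv; have kv : v \in ker_pred by rewrite ker_predE; apply/eqP.
by exists (Sub v kv); rewrite SubK.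
Qed.

End Kernel.

Lemma linear_map (R : pzRingType) (V W : lmodType R) (f : V -> W) :
  linear f -> exists g : {linear V -> W}, g =1 f.
Proof.
move=> lin; pose g : {linear V -> W} := HB.pack f (GRing.isLinear.Build _ _ _ _ f lin).
by exists g.
Qed.

Section Splitting.
Variables (R : comPzRingType) (V : lmodType R) (f : {linear V -> R^o}) (e : V).
Hypothesis fe : f e = 1.

Lemma kernel_proj v : exists u : kernel f, val u = v - f v *: e.
Proof.
apply: kernel_intro; rewrite linearB linearZ fe /=.
have -> : f v *: (1 : R^o) = f v by exact: mulr1.
by rewrite subrr.
Qed.

(** V is the direct sum of the kernel of f and the line spanned by e. A free
    choice of the model L of the line and of the model W of V serves both the
    splitting of P and the cancellation of a row vector space. *)
Lemma split_form (W L : lmodType R) (phi : {linear V -> W}) (t : {linear L -> R^o}) :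
  bijective phi -> bijective t -> lmod_iso (kernel f * L)%type W.
Proof.
move=> bphi [t' tK t'K].
pose g (p : kernel f * L) : W := phi (val p.1 + t p.2 *: e).
have lin : linear g.
  move=> a [u x] [v y]; rewrite /g -linearP; congr (phi _).
  change (\val (a *: u + v) + t (a *: x + y) *: e =
    a *: (\val u + t x *: e) + (\val v + t y *: e)).
  have -> : \val (a *: u + v) = a *: \val u + \val v by exact: linearP.
  rewrite linearP scalerDl scalerDr scalerA.
  by rewrite addrACA.
have [G Gg] := linear_map lin; exists G.
have [phi' phiK phi'K] := bphi.
pose pr v : kernel f := projT1 (cid (kernel_proj v)).
have prE v : val (pr v) = v - f v *: e by exact: (projT2 (cid (kernel_proj v))).
exists (fun y => (pr (phi' y), t' (f (phi' y)))) => [[u x]|y]; rewrite Gg /g /=.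
  have fux : f (val u + t x *: e) = t x.
    by rewrite linearD linearZ /= kernelP fe add0r; exact: mulr1.
  rewrite phiK fux tK; congr pair; apply: val_inj.
  by rewrite prE fux addrK.
by rewrite prE t'K subrK phi'K.
Qed.

End Splitting.

Lemma lmod_iso_sym (R : pzRingType) (M N : lmodType R) : lmod_iso M N -> lmod_iso N M.
Proof.
move=> [f [g fK gK]]; have lin : linear g.
  by move=> a x y; apply: (can_inj fK); rewrite linearP !gK.
by have [G GE] := linear_map lin; exists G; exists f => x; rewrite GE.
Qed.

Lemma split_line (R : comPzRingType) (V : lmodType R) (f : {linear V -> R^o}) e :
  f e = 1 -> exists Q : lmodType R, lmod_iso V (Q * R^o)%type.
Proof.
move=> fe; exists (kernel f); apply: lmod_iso_sym.
have bid (W : lmodType R) : bijective (idfun : {linear W -> W}) by exists idfun.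
exact: (split_form fe (bid V) (bid R^o)).
Qed.

(** * Completing a unimodular row of length three *)

Section Row3.
Variable S : comNzRingType.

Definition row3 (a b c : S) : 'rV[S]_(2 + 1) :=
  \row_i (if i == 0 :> nat then a else if i == 1%N :> nat then b else c).

Definition i0 : 'I_(2 + 1) := @Ordinal (2 + 1) 0 isT.
Definition i1 : 'I_(2 + 1) := @Ordinal (2 + 1) 1 isT.
Definition i2 : 'I_(2 + 1) := @Ordinal (2 + 1) 2 isT.

Definition det3 (u v x : 'rV[S]_(2 + 1)) : S :=
  u 0 i0 * (v 0 i1 * x 0 i2 - v 0 i2 * x 0 i1)
  - u 0 i1 * (v 0 i0 * x 0 i2 - v 0 i2 * x 0 i0)
  + u 0 i2 * (v 0 i0 * x 0 i1 - v 0 i1 * x 0 i0).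

Definition comb3 (a u v x : 'rV[S]_(2 + 1)) : 'rV[S]_(2 + 1) :=
  a 0 i0 *: u + a 0 i1 *: v + a 0 i2 *: x.

Lemma det3_comb (a b c u v x : 'rV[S]_(2 + 1)) :
  det3 (comb3 a u v x) (comb3 b u v x) (comb3 c u v x) = det3 a b c * det3 u v x.
Proof. by rewrite /det3 /comb3 !mxE; ring. Qed.

(** The kernel of a unimodular row is stably free of rank 2, hence free. A basis
    of it and the vector x on which the row takes the value 1 form a basis of
    S^3, so their determinant is a unit, which is absorbed into the first basis
    vector. *)
Lemma kernel_basis (c a b x0 x1 x2 : S) : free_cancellative S 2 ->
  c * x0 + a * x1 + b * x2 = 1 ->
  exists e0 p0 q0 e1 p1 q1 : S,
    [/\ c * e0 + a * p0 + b * q0 = 0, c * e1 + a * p1 + b * q1 = 0,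
        forall s t1 t2, c * s + a * t1 + b * t2 = 0 ->
          exists l m, s = l * e0 + m * e1
      & e0 * (p1 * x2 - q1 * x1) - p0 * (e1 * x2 - q1 * x0)
          + q0 * (e1 * x1 - p1 * x0) = 1].
Proof.
move=> canc row1.
have [f fE] : exists f : {linear 'rV[S]_(2 + 1) -> S^o},
    forall v, f v = c * v 0 i0 + a * v 0 i1 + b * v 0 i2.
  apply: linear_map => k u v; rewrite !mxE /GRing.scale /=; ring.
pose x := row3 x0 x1 x2.
have fx : f x = 1 by rewrite fE !mxE.
have isoS : lmod_iso (kernel f * 'rV[S]_1)%type ('rV[S]_2 * 'rV[S]_1)%type.
  have [phi phiE] : exists phi : {linear 'rV[S]_(2 + 1) -> ('rV[S]_2 * 'rV[S]_1)%type},
      forall v, phi v = (lsubmx v, rsubmx v).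
    by apply: linear_map => k u v; rewrite !linearP.
  have [t tE] : exists t : {linear 'rV[S]_1 -> S^o}, forall v, t v = v 0 0.
    by apply: linear_map => k u v; rewrite !mxE.
  apply: (split_form fx (phi := phi) (t := t)).
    exists (fun p => row_mx p.1 p.2) => [v|[u v]]; rewrite phiE /=.
      exact: hsubmxK.
    by rewrite row_mxKl row_mxKr.
  exists (fun s => \row_i s) => [v|s]; rewrite tE ?mxE //.
  by apply/rowP => i; rewrite !mxE !ord1.
have [g [g' gK g'K]] := canc (kernel f) 1%N isoS.
pose m (i : 'I_2) : 'rV[S]_(2 + 1) := val (g' (delta_mx 0 i)).
have fm i : f (m i) = 0 by apply: kernelP.
have span_m v : f v = 0 -> exists l0 l1, v = l0 *: m ord0 + l1 *: m ord_max.
  move=> /kernel_intro[u <-]; exists (g u 0 ord0), (g u 0 ord_max).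
  have {1}-> : u = g u 0 ord0 *: g' (delta_mx 0 ord0) +
                g u 0 ord_max *: g' (delta_mx 0 ord_max).
    apply: (can_inj gK); rewrite linearD !linearZ /= !g'K.
    apply/rowP => i; rewrite !mxE /=; case: (unliftP ord_max i) => [j ->|->].
      by rewrite !ord1 /= !mulr1 !mulr0 addr0; congr (g u 0 _); apply: val_inj.
    by rewrite /= mulr0 mulr1 add0r.
  by rewrite linearD !linearZ.
have span_x v : exists k : 'rV[S]_(2 + 1), v = comb3 k (m ord0) (m ord_max) x.
  have [|l0 [l1 E]] := span_m (v - f v *: x).
    by rewrite linearB linearZ fx /= [_ *: _]mulr1 subrr.
  exists (row3 l0 l1 (f v)); rewrite /comb3 !mxE /= -E.
  by rewrite subrK.
have [k0 E0] := span_x (row3 1 0 0).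
have [k1 E1] := span_x (row3 0 1 0).
have [k2 E2] := span_x (row3 0 0 1).
pose D := det3 k0 k1 k2.
have DE : D * det3 (m ord0) (m ord_max) x = 1.
  by rewrite /D -det3_comb -E0 -E1 -E2 /det3 !mxE /=; ring.
exists (D * m ord0 0 i0), (D * m ord0 0 i1), (D * m ord0 0 i2).
exists (m ord_max 0 i0), (m ord_max 0 i1), (m ord_max 0 i2); split.
- have := fm ord0; rewrite fE => E.
  by rewrite !(mulrCA _ D) -!mulrDr E mulr0.
- by have := fm ord_max; rewrite fE.
- move=> s t1 t2 st.
  have [|l0 [l1 E]] := span_m (row3 s t1 t2); first by rewrite fE !mxE.
  exists (l0 * det3 (m ord0) (m ord_max) x), l1.
  have := congr1 (fun v : 'rV[S]_(2 + 1) => v 0 i0) E; rewrite !mxE /= => ->.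
  set d3 := det3 _ _ _ in DE *.
  have -> : l0 * d3 * (D * m ord0 0 i0) = l0 * (D * d3) * m ord0 0 i0 by ring.
  by rewrite DE mulr1.
- rewrite -DE /det3 !mxE /=; ring.
Qed.

End Row3.

(** * Changing the orientation *)

Section Reorient.
Variables (R : comNzRingType) (P : lmodType R) (d : nat).
Hypothesis noeR : noetherian R.
Variable w : {ffun 'I_d -> P} -> R^o.
Hypothesis alt_w : alternating w.
Variable alpha : {linear P -> R^o}.
Variable J : set R.
Hypothesis idJ : ideal J.
Hypothesis alphaJ : range alpha = J.
Variables (p : {ffun 'I_d -> P}) (i0 i1 : 'I_d).
Hypotheses (i00 : i0 = 0%N :> nat) (i11 : i1 = 1%N :> nat).
Hypothesis Jp : J `<=` tail alpha p 0.
Hypothesis wpJ : forall u, prime_ideal u -> J `<=` u -> ~ u (w p).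
Variables (S : comNzRingType) (pi : {rmorphism R -> S}).
Hypothesis pi_surj : forall y, exists x, pi x = y.
Hypothesis pi0 : forall x, pi x = 0 <-> tail alpha p 2 x.
Hypothesis cancS : free_cancellative S 2.

Let c : R := w p.
Let f0 : R := alpha (p i0).
Let f1 : R := alpha (p i1).
Let I2 := tail alpha p 2.

Let idI2 : ideal I2. Proof. exact: tail_ideal. Qed.

Let Jal x : J (alpha x). Proof. by rewrite -alphaJ; exists x. Qed.

Let I2J : I2 `<=` J. Proof. exact: tail_min. Qed.

Let i01 : i0 != i1. Proof. by rewrite -val_eqE /= i00 i11. Qed.

Let tail0_cases I : ideal I -> I f0 -> I f1 -> I2 `<=` I -> tail alpha p 0 `<=` I.
Proof.
move=> idI If0 If1 I2I; apply: tail_min => // i _.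
have [->//|ne0] := eqVneq i i0; have [->//|ne1] := eqVneq i i1.
apply: I2I; apply: mem_tail.
move: ne0 ne1; rewrite -!val_eqE /= i00 i11.
by case: (nat_of_ord i) => [|[|]].
Qed.

Let unit_mod_J : exists s, J (1 - s * c).
Proof.
have : gen (J `|` [set c]) 1.
  apply: ideal_no_prime => //; first exact: gen_ideal.
  move=> u hu Ku; apply: (wpJ hu).
    by move=> x Jx; apply: Ku; apply: sub_gen; left.
  by apply: Ku; apply: sub_gen; right.
by case/gen_add1 => // y Jy [s ->]; exists s; rewrite addrK.
Qed.

(** Let s be inverse to c modulo J. The row (c, f0, f1) is unimodular over
    S = R / I2; let the (e_j, p_j, q_j) form a basis of its
    kernel as in [kernel_basis]. Then
    e_0, e_1 generate J modulo I2, because the first coordinates of kernel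
    vectors are the t with c t in (f0, f1). Modulo I2 + J e_j, the element e_j
    is - s (p_j f0 + q_j f1), and the normalization of the determinant says
    p_0 q_1 - q_0 p_1 = c modulo J. So the change from (f0, f1) to (e_0, e_1)
    has determinant s^2 c = s modulo J, and lifting it to P turns w p = c
    into 1. *)
Lemma reorient : exists p',
  [/\ J (w p' - 1), J `<=` tail alpha p' 0
    & forall i : 'I_d, (2 <= i)%N -> p' i = p i].
Proof.
have [s Js] := unit_mod_J.
have [x1 [x2 I2x]] : exists x1 x2, I2 (1 - s * c - f0 * x1 - f1 * x2).
  pose K : set R := [set y | exists x1 x2, I2 (y - f0 * x1 - f1 * x2)].
  have idK : ideal K.
    apply/idealP; split.
    - by exists 0, 0; rewrite !mulr0 !subr0; apply: ideal0.
    - move=> y z [y1 [y2 Iy]] [z1 [z2 Iz]]; exists (y1 + z1), (y2 + z2).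
      rewrite (_ : _ - _ = (y - f0 * y1 - f1 * y2) + (z - f0 * z1 - f1 * z2)); last by ring.
      exact: (idealD idI2 Iy Iz).
    - move=> a y [y1 [y2 Iy]]; exists (a * y1), (a * y2).
      rewrite (_ : _ - _ = a * (y - f0 * y1 - f1 * y2)); last by ring.
      exact: (idealMl a idI2 Iy).
  suff sub : tail alpha p 0 `<=` K by apply: sub; apply: Jp.
  apply: tail0_cases => //.
  - by exists 1, 0; rewrite mulr1 mulr0 subrr subr0; apply: ideal0.
  - by exists 0, 1; rewrite mulr1 mulr0 subr0 subrr; apply: ideal0.
  - by move=> y Iy; exists 0, 0; rewrite !mulr0 !subr0.
have Epi x y : pi x = pi y -> I2 (x - y).
  by move=> E; apply/pi0; rewrite rmorphB E subrr.
have piE x y : I2 (x - y) -> pi x = pi y.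
  by move/pi0/eqP; rewrite rmorphB subr_eq0 => /eqP.
have row : pi c * pi s + pi f0 * pi x1 + pi f1 * pi x2 = 1.
  rewrite -!rmorphM -!rmorphD -(rmorph1 pi); apply/esym/piE.
  by rewrite (_ : _ - _ = 1 - s * c - f0 * x1 - f1 * x2) //; ring.
have [e0 [p0 [q0 [e1 [p1 [q1 [k0 k1 kgen kdet]]]]]]] := kernel_basis cancS row.
move: k0 k1 kgen kdet.
have [E0 <-] := pi_surj e0; have [P0 <-] := pi_surj p0; have [Q0 <-] := pi_surj q0.
have [E1 <-] := pi_surj e1; have [P1 <-] := pi_surj p1; have [Q1 <-] := pi_surj q1.
rewrite -!(rmorphM, rmorphB, rmorphD) -(rmorph1 pi) => /pi0 k0 /pi0 k1 kgen /Epi kdet.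
have {}kgen x t1 t2 : I2 (c * x + f0 * t1 + f1 * t2) ->
    exists l m, I2 (x - (l * E0 + m * E1)).
  move=> /pi0; rewrite !(rmorphM, rmorphD) => /kgen[l [m]].
  have [L <-] := pi_surj l; have [M <-] := pi_surj m.
  by rewrite -!(rmorphM, rmorphD) => /Epi h; exists L, M.
have JE E P' Q : I2 (c * E + f0 * P' + f1 * Q) -> J E.
  move=> /I2J h.
  rewrite (_ : E = (1 - s * c) * E + s * (c * E + f0 * P' + f1 * Q)
    - (s * P') * f0 - (s * Q) * f1); last by ring.
  apply: idealB => //; [apply: idealB => //; [apply: idealD => //|]|].
  - exact: idealMr.
  - exact: idealMl.
  - by apply: idealMl => //; apply: Jal.
  - by apply: idealMl => //; apply: Jal.
have JE0 := JE _ _ _ k0; have JE1 := JE _ _ _ k1.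
have [z0 z0E] : exists z, alpha z = E0 by move: JE0; rewrite -alphaJ => -[z _ <-]; exists z.
have [z1 z1E] : exists z, alpha z = E1 by move: JE1; rewrite -alphaJ => -[z _ <-]; exists z.
(* The summand (1 - s * c) *: z, with z over E, corrects the image from s c E
   to E and is invisible to w modulo J. *)
pose g P' Q z := (- (s * P')) *: p i0 + (- (s * Q)) *: p i1 + (1 - s * c) *: z.
pose p' := upd (upd p i0 (g P0 Q0 z0)) i1 (g P1 Q1 z1).
have p'0 : p' i0 = g P0 Q0 z0 by rewrite /p' upd_other // upd_same.
have p'1 : p' i1 = g P1 Q1 z1 by rewrite /p' upd_same.
have p'i (i : 'I_d) : (2 <= i)%N -> p' i = p i.
  move=> i2; rewrite /p' !upd_other // -val_eqE /= ?i00 ?i11.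
    by apply/eqP => E; rewrite E in i2.
  by apply/eqP => E; rewrite E in i2.
exists p'; split => //.
- pose W x y := w (upd (upd p i0 x) i1 y).
  have WDl x y z : W (x + y) z = W x z + W y z.
    by rewrite /W !(updC _ _ _ i01) altD.
  have WDr x y z : W z (x + y) = W z x + W z y by rewrite /W altD.
  have WZl a x z : W (a *: x) z = a * W x z.
    by rewrite /W !(updC _ _ _ i01) altZ.
  have WZr a x z : W z (a *: x) = a * W z x by rewrite /W altZ.
  have W0 x : W x x = 0.
    by apply: (alt_eq alt_w i01); rewrite upd_same upd_other // upd_same.
  have W01 : W (p i0) (p i1) = c.
    by rewrite /W upd_id upd_id.
  have W10 : W (p i1) (p i0) = - c by rewrite /W alt_swap // -/(W _ _) W01.
  have [r Er] : exists r : R, w p' = s * s * (P0 * Q1 - Q0 * P1) * c + (1 - s * c) * r.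
    pose a P' Q := (- (s * P')) *: p i0 + (- (s * Q)) *: p i1.
    exists (W (a P0 Q0) z1 + W z0 (g P1 Q1 z1)).
    rewrite -[w p']/(W (a P0 Q0 + (1 - s * c) *: z0) (g P1 Q1 z1)) WDl WZl.
    rewrite -[g P1 Q1 z1]/(a P1 Q1 + (1 - s * c) *: z1).
    rewrite [W (a P0 Q0) (_ + _)]WDr [W (a P0 Q0) (_ *: z1)]WZr.
    rewrite {1 2}/a !(WDl, WDr, WZl, WZr) !W0 W01 W10; ring.
  rewrite Er.
  rewrite (_ : _ - 1 = (E0 * (P1 * x2 - Q1 * x1) - P0 * (E1 * x2 - Q1 * s) +
      Q0 * (E1 * x1 - P1 * s) - 1) * (s * c)
    - (P1 * x2 - Q1 * x1) * (s * c) * E0 + (P0 * x2 - Q0 * x1) * (s * c) * E1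
    + (r - 1) * (1 - s * c)); last by ring.
  apply: idealD => //; last exact: idealMl.
  apply: idealD => //; last exact: idealMl.
  apply: idealB => //; last exact: idealMl.
  by apply: idealMr => //; apply: I2J.
- have idT := tail_ideal alpha p' 0.
  have I2T : I2 `<=` tail alpha p' 0.
    by apply: tail_min => // i i2; rewrite -p'i //; apply: mem_tail.
  have TE E P' Q z (i : 'I_d) : p' i = g P' Q z -> alpha z = E ->
      I2 (c * E + f0 * P' + f1 * Q) -> tail alpha p' 0 E.
    move=> p'iE zE kE.
    have Tg : tail alpha p' 0 (alpha (p' i)) by exact: mem_tail.
    rewrite (_ : E = alpha (p' i) + s * (c * E + f0 * P' + f1 * Q)).
      exact: (idealD idT Tg (idealMl s idT (I2T _ kE))).
    rewrite p'iE /g !linearD !linearZ /= zE -/f0 -/f1 /GRing.scale /=; ring.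
  have TE0 := TE _ _ _ _ _ p'0 z0E k0; have TE1 := TE _ _ _ _ _ p'1 z1E k1.
  have Tf f t1 t2 : I2 (c * f + f0 * t1 + f1 * t2) -> tail alpha p' 0 f.
    move=> /kgen[l [m h]]; rewrite -[f](subrK (l * E0 + m * E1)).
    apply: (idealD idT (I2T _ h)).
    exact: (idealD idT (idealMl l idT TE0) (idealMl m idT TE1)).
  apply: subset_trans Jp _; apply: tail0_cases => //.
    by apply: (Tf f0 (- c) 0); rewrite (_ : _ + _ = 0); [exact: ideal0|ring].
  by apply: (Tf f1 0 (- c)); rewrite (_ : _ + _ = 0); [exact: ideal0|ring].
Qed.

End Reorient.

(** * The splitting *)

(** The exterior power identified with R turns into an alternating form on P
    of which every alternating map on P^d is a multiple. *)
Lemma volume_form (R : comNzRingType) (P : lmodType R) d :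
  exterior_power_iso P d R^o ->
  exists2 w : {ffun 'I_d -> P} -> R^o, alternating w
    & forall (N : lmodType R) (f : {ffun 'I_d -> P} -> N), alternating f ->
        exists n0 : N, forall v, f v = w v *: n0.
Proof.
move=> [E [w0 [[[lin_w0 alt_w0] univ_w0] [phi [psi phiK psiK]]]]].
exists (fun v => phi (w0 v)).
  split=> [v i a x y|v i j ij vij]; first by rewrite lin_w0 linearP.
  by rewrite (alt_w0 v i j ij vij) linear0.
move=> N f /univ_w0[g gw _]; exists (g (psi 1)) => v.
rewrite -gw -linearZ; congr (g _); apply: (can_inj phiK).
by rewrite linearZ psiK /=; symmetry; exact: mulr1.
Qed.

Lemma tail_ext (R : comNzRingType) (P : lmodType R) d (alpha : {linear P -> R^o})
    (p q : {ffun 'I_d -> P}) n :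
  (forall i : 'I_d, (n <= i)%N -> alpha (p i) = alpha (q i)) ->
  tail alpha p n = tail alpha q n.
Proof.
move=> pq; apply/seteqP; split; (apply: tail_min => [|i ni];
  first exact: tail_ideal).
  by rewrite pq //; apply: mem_tail.
by rewrite -pq //; apply: mem_tail.
Qed.

Theorem theorem6p2 (A : comPzRingType) (hA : noetherian A)
    (hcancel : forall S : comAlgType A,
       finite_type S -> krull_dim_le S 2 -> free_cancellative S 2)
    (R : comAlgType A) (hR : finite_type R)
    (d : nat) (hd : (2 <= d)%N) (hdim : krull_dim R d)
    (P : lmodType R) (hP : projective_of_rank P d)
    (hdet : exterior_power_iso P d R^o)
    (J : set R^o) (hJ : ideal J) (alpha : {linear P -> R^o})
    (halpha : range alpha = J) (hht : ideal_height J d)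
    (hgen : exists g : 'I_d -> R^o, generated_by g J) :
  exists Q : lmodType R, lmod_iso P (Q * R^o)%type.
Proof.
have noeR : noetherian R by exact: finite_type_noetherian hA hR.
have Jmax := height_dim_maxprime hdim hht.
have [_ _ rkP] := hP.
have [w alt_w univ_w] := volume_form hdet.
pose i0 : 'I_d := Ordinal (ltnW hd); pose i1 : 'I_d := Ordinal hd.
have J1 : ~ J 1.
  have [[q [hq Jq _]] _] := hht; move=> /Jq; exact: prime1.
have [p Jp] : exists p : {ffun 'I_d -> P}, J `<=` tail alpha p 0.
  have [g gJ] := hgen.
  have im i : exists x, alpha x = g i.
    have : J (g i).
      rewrite gJ; exists (fun j => (j == i)%:R) => //.
      rewrite (bigD1 i) //= eqxx scale1r big1 ?addr0 // => j /negbTE ->.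
      by rewrite scale0r.
    by rewrite -halpha => -[x _ <-]; exists x.
  have [x xg] := choice im; exists [ffun i => x i].
  rewrite gJ => _ [a _ <-]; apply: ideal_sum => [|i _]; first exact: tail_ideal.
  have gi : tail alpha [ffun i => x i] 0 (g i).
    by rewrite -xg -(ffunE x i); apply: mem_tail.
  exact: (idealMl (a i) (tail_ideal _ _ _) gi).
have [p2 Jp2 dimp2] := general_generators noeR alt_w Jmax (proj2 hdim) Jp hd.
have nz (u : set R) : prime_ideal u -> exists v, ~ u (w v).
  by move=> hu; have [] := volume_local univ_w hu (rkP u hu).
have [p3 [alp3 wp3]] := lift_generators noeR alt_w halpha Jmax hJ Jp2 nz.
have tail3 n : tail alpha p3 n = tail alpha p2 n by apply: tail_ext.
have Jp3 : J `<=` tail alpha p3 0 by rewrite tail3.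
have id2 : ideal (tail alpha p3 2) by exact: tail_ideal.
have n21 : ~ tail alpha p3 2 1.
  move=> t1; apply: J1; move: (1 : R) t1; apply: tail_min => // i _.
  by rewrite -halpha; exists (p3 i).
pose S : comAlgType A := quot_alg id2 n21.
have cancS : free_cancellative S 2.
  apply: hcancel; first exact: quot_finite_type.
  by apply: quot_dim; rewrite tail3.
have [p4 [wp4 Jp4 p4i]] := @reorient _ _ _ noeR w alt_w alpha J hJ halpha p3 i0 i1
  erefl erefl Jp3 wp3 S (@quot_pi _ _ _ id2 n21) (@quot_pi_surj _ _ _ id2 n21)
  (@quot_pi0 _ _ _ id2 n21) cancS.
have dimp4 : dim_over (tail alpha p4 2) 2.
  by rewrite (tail_ext (q := p3)) ?tail3 // => i /p4i ->.
have [p5 [wp5 Jp5 dimp5]] := cut_dimension noeR alt_w Jmax (k := i1) Jp4 dimp4.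
have ext (u : set R) i x : prime_ideal u -> ~ u (alpha x) ->
    exists v : {ffun 'I_d -> P}, ~ u (w (upd v i x)).
  by move=> hu; apply: volume_extend univ_w _ _ _ _ _ _ => //; apply: rkP.
have [phi [e phie]] := unimodular_form noeR hd alt_w ext hJ halpha
  (i0 := i0) erefl Jp5 dimp5 (eq_ind_r (fun z => J (z - 1)) wp4 wp5).
exact: split_line phie.
Qed.
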